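(* Let $K$ be a field with $\operatorname{char}K\neq2,3$ and let $(\lambda,\mu)\in\Lambda_{a,b}$. Then the permutation module $M^{\lambda,\mu}$ of $K\mathfrak S_{a,b}$ has a dual Specht filtration.
   Context: Modules are finite-dimensional right modules. $\mathfrak S_a$ is the symmetric group and $\mathfrak S_{a,b}=\mathfrak S_a\times\mathfrak S_b$. $\Lambda_{a,b}$ is the set of pairs $(\lambda,\mu)$ with $\lambda\vdash a$, $\mu\vdash b$. $M^\lambda$ is the $K\mathfrak S_a$-module with basis the $\lambda$-tabloids (the permutation module induced from the trivial module of the Young subgroup $\mathfrak S_\lambda$), and $M^{\lambda,\mu}=M^\lambda\boxtimes_KM^\mu$. The Specht module $S^\lambda\subseteq M^\lambda$ is generated by a polytabloid $\{\mathfrak t\}\cdot\sum_{\sigma\in C_{\mathfrak t}}(\operatorname{sgn}\sigma)\sigma$ ($C_{\mathfrak t}$ the column stabilizer of the $\lambda$-tableau $\mathfrak t$); $S^{\lambda,\mu}=S^\lambda\boxtimes_KS^\mu$. The dual Specht module is $S_{\lambda,\mu}=(S^{\lambda,\mu})^*\cong S_\lambda\boxtimes_K S_\mu$, where $S_\lambda=(S^\lambda)^*$. A dual Specht filtration of a $K\mathfrak S_{a,b}$-module $M$ is a finite chain of submodules $M=M_0\supseteq M_1\supseteq\cdots\supseteq M_{k+1}=0$ with each $M_i/M_{i+1}$ isomorphic to some dual Specht module $S_{\alpha,\beta}$, $(\alpha,\beta)\in\Lambda_{a,b}$. *)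

(* Defs.v *)
From HB Require Import structures.
From mathcomp Require Import all_boot all_algebra all_fingroup.
From mathcomp Require Import mxrepresentation.
From mathcomp Require Import mxtens.

Set Implicit Arguments.
Unset Strict Implicit.
Unset Printing Implicit Defensive.

Import GRing.Theory GroupScope.
Local Open Scope ring_scope.

(* Conventions. The product of 'S_n composes from left to right, and a
   representation rG acts on row vectors by v |-> v *m rG g, so a
   representation is a right module; a submodule is given by a square matrix
   U with mxmodule rG U, and stands for the row space of U. *)

Section PermutationModule.

Variables (gT : finGroupType) (T : finType) (to : {action gT &-> T}).
Variable (K : fieldType).

Definition perm_module_mx (g : gT) : 'M[K]_#|T| :=
  \matrix_(i, j) (enum_val j == to (enum_val i) g)%:R.

Lemma perm_module_mx_repr : mx_repr [set: gT] perm_module_mx.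
Proof.
split=> [|g h _ _]; apply/matrixP=> i j; rewrite !mxE.
  by rewrite act1 (inj_eq enum_val_inj) eq_sym.
rewrite (bigD1 (enum_rank (to (enum_val i) g))) //= big1 ?addr0.
  by rewrite !mxE enum_rankK eqxx mul1r actM.
move=> k ne_k; rewrite mxE; case: eqP => [Ek|]; last by rewrite mul0r.
by rewrite -Ek enum_valK eqxx in ne_k.
Qed.

Definition perm_module : mx_representation K [set: gT] #|T| :=
  MxRepresentation perm_module_mx_repr.

End PermutationModule.

Section Dual.

Variables (K : fieldType) (gT : finGroupType) (G : {group gT}) (n : nat).
Variable rG : mx_representation K G n.

(* (f g)(v) = f (v g^-1), where the row vector f stands for the linear form
   v |-> v *m f^T. *)
Definition dual_mx (g : gT) : 'M[K]_n := (rG g^-1%g)^T.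

Lemma dual_mx_repr : mx_repr G dual_mx.
Proof.
split=> [|g h Gg Gh]; first by rewrite /dual_mx invg1 repr_mx1 trmx1.
by rewrite /dual_mx invMg repr_mxM ?groupV // trmx_mul.
Qed.

Definition dual_repr : mx_representation K G n := MxRepresentation dual_mx_repr.

End Dual.

Section OuterTensor.

Variables (K : fieldType) (gT1 gT2 : finGroupType).
Variables (G1 : {group gT1}) (G2 : {group gT2}) (n1 n2 : nat).
Variables (r1 : mx_representation K G1 n1) (r2 : mx_representation K G2 n2).

Definition outer_mx (g : gT1 * gT2) : 'M[K]_(n1 * n2) :=
  tensmx (r1 g.1) (r2 g.2).

Lemma outer_mx_repr : mx_repr (setX G1 G2) outer_mx.
Proof.
split=> [|[g1 g2] [h1 h2] /setXP[Gg1 Gg2] /setXP[Gh1 Gh2]].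
  rewrite /outer_mx /= !repr_mx1; apply/matrixP=> i j.
  case: (mxtens_indexP i) => i1 i2; case: (mxtens_indexP j) => j1 j2.
  rewrite tensmxE !mxE -natrM mulnb.
  by rewrite (inj_eq (can_inj (@mxtens_indexK _ _))) xpair_eqE.
by rewrite /outer_mx /= !repr_mxM // tensmx_mul.
Qed.

Definition outer_repr : mx_representation K (setX G1 G2) (n1 * n2) :=
  MxRepresentation outer_mx_repr.

End OuterTensor.

Definition is_partition (n : nat) (s : seq nat) : bool :=
  [&& sorted geq s, 0%N \notin s & sumn s == n].

Record intpart (n : nat) := IntPart {
  parts :> seq nat;
  partsP : is_partition n parts }.

Section Tableaux.

Variables (n : nat) (lam : intpart n).

(* The box in row i and column j of the Young diagram, both counted from 0. *)
Definition box : finType :=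
  {i : 'I_(size lam) & 'I_(nth 0%N lam i)} : finType.
Definition box_row (b : box) : nat := tag b.
Definition box_col (b : box) : nat := tagged b.

(* There are n boxes, so that an injective filling is a bijection. *)
Definition tableau : finType :=
  {t : {ffun box -> 'I_n} | injectiveb t} : finType.

Definition row_set (t : tableau) (i : nat) : {set 'I_n} :=
  [set val t b | b : box & box_row b == i].
Definition col_set (t : tableau) (j : nat) : {set 'I_n} :=
  [set val t b | b : box & box_col b == j].

Definition col_stab (t : tableau) : {set 'S_n} :=
  [set s : 'S_n | [forall b : box,
    s @: col_set t (box_col b) == col_set t (box_col b)]].

Lemma tableau_act_subproof (t : tableau) (s : 'S_n) :
  injectiveb [ffun b => s (val t b)].
Proof.
apply/injectiveP=> b c; rewrite !ffunE => /perm_inj.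
by have /injectiveP := valP t; apply.
Qed.

Definition tableau_act_fun (t : tableau) (s : 'S_n) : tableau :=
  Sub [ffun b => s (val t b)] (tableau_act_subproof t s).

Lemma tableau_act1 : tableau_act_fun^~ 1%g =1 id.
Proof. by move=> t; apply/val_inj/ffunP=> b; rewrite ffunE perm1. Qed.

Lemma tableau_actM (t : tableau) : act_morph tableau_act_fun t.
Proof. by move=> s u; apply/val_inj/ffunP=> b; rewrite !ffunE permM. Qed.

Definition tableau_act : {action 'S_n &-> tableau} :=
  TotalAction tableau_act1 tableau_actM.

Definition row_equiv (t u : tableau) : bool :=
  [forall b : box, row_set t (box_row b) == row_set u (box_row b)].

Definition row_class (t : tableau) : {set tableau} := [set u | row_equiv t u].

Definition tabloid : finType :=
  {A : {set tableau} | A \in [set row_class t | t : tableau]} : finType.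

Lemma tabloid_of_subproof (t : tableau) :
  row_class t \in [set row_class u | u : tableau].
Proof. exact: imset_f. Qed.

Definition tabloid_of (t : tableau) : tabloid :=
  Sub (row_class t) (tabloid_of_subproof t).

Lemma row_set_act (t : tableau) (s : 'S_n) i :
  row_set (tableau_act t s) i = s @: row_set t i.
Proof.
rewrite /row_set -imset_comp; apply: eq_imset => b /=.
by rewrite ffunE.
Qed.

Lemma row_class_act (t : tableau) (s : 'S_n) :
  (tableau_act^*)%act (row_class t) s = row_class (tableau_act t s).
Proof.
have E (u v : tableau) : row_equiv (tableau_act u s) (tableau_act v s)
    = row_equiv u v.
  apply: eq_forallb => b.
  by rewrite !row_set_act (inj_eq (imset_inj (@perm_inj _ s))).
apply/setP=> u; rewrite inE; apply/imsetP/idP => [[v] | tu].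
  by rewrite inE => tv ->; rewrite E.
exists (tableau_act u s^-1%g); last by rewrite actKV.
by rewrite inE -E actKV.
Qed.

Lemma tabloid_act_subproof (A : tabloid) (s : 'S_n) :
  (tableau_act^*)%act (val A) s \in [set row_class t | t : tableau].
Proof.
by have /imsetP[t _ ->] := valP A; rewrite row_class_act imset_f.
Qed.

Definition tabloid_act_fun (A : tabloid) (s : 'S_n) : tabloid :=
  Sub ((tableau_act^*)%act (val A) s) (tabloid_act_subproof A s).

Lemma tabloid_act1 : tabloid_act_fun^~ 1%g =1 id.
Proof. by move=> A; apply: val_inj; rewrite /= act1. Qed.

Lemma tabloid_actM (A : tabloid) : act_morph tabloid_act_fun A.
Proof. by move=> s u; apply: val_inj; rewrite /= actM. Qed.

Definition tabloid_act : {action 'S_n &-> tabloid} :=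
  TotalAction tabloid_act1 tabloid_actM.

(* Reading the rows of std_tableau from top to bottom gives 0, ..., n - 1. *)
Lemma std_tableau_bound (b : box) :
  (flatten_index lam (box_row b) (box_col b) < n)%N.
Proof.
have /and3P[_ _ /eqP def_n] := partsP lam.
by rewrite -[X in (_ < X)%N]def_n flatten_indexP // /box_col ltn_ord.
Qed.

Definition std_filling : {ffun box -> 'I_n} :=
  [ffun b => Ordinal (std_tableau_bound b)].

Lemma std_tableau_inj : injectiveb std_filling.
Proof.
apply/injectiveP=> b c; rewrite !ffunE => /(congr1 val) /= Ebc.
have := congr1 (reshape_index lam) Ebc; have := congr1 (reshape_offset lam) Ebc.
rewrite !flatten_indexKl ?flatten_indexKr ?ltn_ord //.
case: b c {Ebc} => [i j] [k l]; rewrite /box_row /box_col /= => Ejl /val_inj Eik.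
by case: _ / Eik l Ejl => l /val_inj ->.
Qed.

Definition std_tableau : tableau := Sub std_filling std_tableau_inj.

Variable K : fieldType.

(* M^lambda *)
Definition Mrep : mx_representation K [set: 'S_n] #|tabloid| :=
  perm_module tabloid_act K.

Definition tabloid_vec (A : tabloid) : 'rV[K]_#|tabloid| :=
  delta_mx 0 (enum_rank A).

Definition polytabloid (t : tableau) : 'rV[K]_#|tabloid| :=
  tabloid_vec (tabloid_of t)
    *m \sum_(s in col_stab t) ((-1) ^+ odd_perm s *: Mrep s).

(* S^lambda as a submodule of M^lambda; by specht_mx_tableau below, it does
   not depend on the tableau chosen. *)
Definition specht_mx : 'M[K]_#|tabloid| :=
  cyclic_mx Mrep (polytabloid std_tableau).

Lemma tabloid_vec_act (A : tabloid) (s : 'S_n) :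
  tabloid_vec A *m Mrep s = tabloid_vec (tabloid_act A s).
Proof.
rewrite -rowE; apply/rowP=> j; rewrite !mxE enum_rankK eqxx /=.
by rewrite -(inj_eq enum_rank_inj) enum_valK.
Qed.

Lemma tabloid_of_act (t : tableau) (s : 'S_n) :
  tabloid_act (tabloid_of t) s = tabloid_of (tableau_act t s).
Proof. by apply: val_inj; rewrite /= row_class_act. Qed.

Lemma col_set_act (t : tableau) (s : 'S_n) i :
  col_set (tableau_act t s) i = s @: col_set t i.
Proof.
rewrite /col_set -imset_comp; apply: eq_imset => b /=.
by rewrite ffunE.
Qed.

Lemma col_stab_act (t : tableau) (s : 'S_n) :
  col_stab (tableau_act t s) = (col_stab t :^ s)%g.
Proof.
apply/setP=> u; rewrite mem_conjg !inE; apply: eq_forallb => b.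
rewrite col_set_act -[RHS](inj_eq (imset_inj (@perm_inj _ s))) -!imset_comp.
congr (_ == _); apply: eq_imset => x /=.
by rewrite conjgE invgK !permM permKV.
Qed.

Lemma polytabloid_act (t : tableau) (s : 'S_n) :
  polytabloid t *m Mrep s = polytabloid (tableau_act t s).
Proof.
rewrite /polytabloid col_stab_act -tabloid_of_act -tabloid_vec_act -!mulmxA.
congr (_ *m _); rewrite mulmx_suml mulmx_sumr.
rewrite [RHS](reindex_inj (conjg_inj s)).
apply: eq_big => u; first by rewrite memJ_conjg.
move=> _; rewrite -scalemxAl -scalemxAr; congr (_ *: _).
  by rewrite odd_permJ.
by rewrite -!repr_mxM ?inE // conjgC.
Qed.

Lemma card_box : #|box| = n.
Proof.
have /and3P[_ _ /eqP <-] := partsP lam.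
rewrite card_tagged !sumnE big_map big_enum /= (big_nth 0%N) big_mkord.
by apply: eq_bigr => i _; rewrite card_ord.
Qed.

Lemma tableau_trans (t u : tableau) : exists s : 'S_n, u = tableau_act t s.
Proof.
have [/injectiveP t_inj /injectiveP u_inj] := (valP t, valP u).
have [|t' tK t'K] := inj_card_bij t_inj; first by rewrite card_ord card_box.
have ut'_inj : injective (fun x => val u (t' x)).
  by move=> x y /u_inj /(can_inj t'K).
by exists (perm ut'_inj); apply/val_inj/ffunP=> b; rewrite ffunE permE tK.
Qed.

Lemma specht_mx_tableau (t : tableau) :
  (cyclic_mx Mrep (polytabloid t) :=: specht_mx)%MS.
Proof.
have le u v : (cyclic_mx Mrep (polytabloid u)
               <= cyclic_mx Mrep (polytabloid v))%MS.
  have [s ->] := tableau_trans v u.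
  rewrite cyclic_mx_sub ?cyclic_mx_module // -polytabloid_act.
  by rewrite mxmodule_trans ?cyclic_mx_module ?inE // cyclic_mx_id.
by apply/eqmxP; rewrite !le.
Qed.

Definition specht_repr : mx_representation K [set: 'S_n] (\rank specht_mx) :=
  submod_repr (cyclic_mx_module Mrep (polytabloid std_tableau)).

End Tableaux.

Section DualSpechtFiltration.

Variables (K : fieldType) (a b : nat).

Definition Sym_prod : {group 'S_a * 'S_b} :=
  setX_group [set: 'S_a]%G [set: 'S_b]%G.

(* M^(lambda, mu) *)
Definition Mrep2 (lam : intpart a) (mu : intpart b) :
    mx_representation K Sym_prod (#|tabloid lam| * #|tabloid mu|) :=
  outer_repr (Mrep lam K) (Mrep mu K).

Definition specht_repr2 (lam : intpart a) (mu : intpart b) :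
    mx_representation K Sym_prod
      (\rank (specht_mx lam K) * \rank (specht_mx mu K)) :=
  outer_repr (specht_repr lam K) (specht_repr mu K).

Definition dual_specht (lam : intpart a) (mu : intpart b) :=
  dual_repr (specht_repr2 lam mu).

(* The terms U i with i > k.+1 are irrelevant. For V <= U, section_repr
   modV modU is the quotient module U / V. *)
Definition has_dual_specht_filtration (n : nat)
    (rG : mx_representation K Sym_prod n) : Prop :=
  exists (k : nat) (U : nat -> 'M[K]_n) (modU : forall i, mxmodule rG (U i)),
    [/\ (U 0%N :=: 1%:M)%MS,
        (U k.+1 :=: (0 : 'M[K]_n))%MS,
        forall i, (i <= k)%N -> (U i.+1 <= U i)%MS
      & forall i, (i <= k)%N ->
          exists (al : intpart a) (be : intpart b),
            mx_rsim (section_repr (modU i.+1) (modU i)) (dual_specht al be)].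

End DualSpechtFiltration.

(* Main.v *)
(* M^mu is the multihomogeneous part of the polynomial ring in letters x_ij that
   is linear in each row i < n and of degree mu_j in column j, and S^lam is
   spanned by the products of initial minors of shape lam. A bideterminant is
   a product of minors of x; it is given by a colouring of the rows i (its
   columns) and by a tabloid. The Garnir relations rewrite a bideterminant,
   modulo bideterminants with more unequal columns, in terms of those whose
   contents are semistandard, or else of those whose places are standard. Hence
   the bideterminants with a fixed semistandard content span a module which,
   modulo the earlier ones, is a quotient of S^lam. Conversely the S_n-linear map
   M^mu -> M^lam attached to the orbit of a semistandard tableau T kills what
   comes before T and sends the bideterminants of content T to the polytabloids,
   of which the standard ones are linearly independent. Hence M^mu has a
   filtration by Specht modules. Such filtrations are preserved by outer tensor
   products, and taking annihilators turns them into filtrations by dual Specht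
   modules, because permutation modules are self-dual. *)

Require Import Defs.
From HB Require Import structures.
From mathcomp Require Import all_boot all_algebra all_fingroup.
From mathcomp Require Import mxrepresentation mxtens zify.

Set Implicit Arguments.
Unset Strict Implicit.
Unset Printing Implicit Defensive.

Import GRing.Theory GroupScope.
Local Open Scope ring_scope.

(** * Subquotients of a module through explicit matrices *)

Section Sections.

Variables (K : fieldType) (gT : finGroupType) (G : {group gT}).

(* [U / V] is isomorphic to [r]: [C] induces the isomorphism and [B] lifts the
   standard basis of [r] to [U]. In this form the notion is visibly stable
   under tensor products and under transposition. *)
Definition is_section n d (rG : mx_representation K G n)
    (r : mx_representation K G d) (V U : 'M[K]_n) : Prop :=
  exists C : 'M_(n, d), exists B : 'M_(d, n),
    [/\ V *m C = 0, B *m C = 1%:M, (B <= U)%MS, (U <= V + B)%MS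
      & forall g, g \in G -> U *m rG g *m C = U *m C *m r g].

Variable n : nat.
Variable rG : mx_representation K G n.

Lemma is_section_eqmx d (r : mx_representation K G d) (V V' U U' : 'M_n) :
  (V :=: V')%MS -> (U :=: U')%MS ->
  is_section rG r V U -> is_section rG r V' U'.
Proof.
move=> eV eU [C [B [VC BC BU UVB CJ]]]; exists C, B.
have /submxP[D defV'] : (V' <= V)%MS by rewrite eV.
have /submxP[E defU'] : (U' <= U)%MS by rewrite eU.
split=> // [||| g Gg].
- by rewrite defV' -mulmxA VC mulmx0.
- by rewrite -eU.
- by rewrite -eU (submx_trans UVB) // addsmxS // eV.
by rewrite defU' -!(mulmxA E) CJ // !mulmxA.
Qed.

Lemma section_rsim d (r : mx_representation K G d) (V U : 'M_n)
    (modV : mxmodule rG V) (modU : mxmodule rG U) :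
  (V <= U)%MS -> is_section rG r V U -> mx_rsim (section_repr modV modU) r.
Proof.
move=> sVU [C [B [VC BC BU UVB CJ]]].
set I := <<in_factmod V U>>%MS.
(* The rows of [W] lift a basis of [U / V] to [U], so [W *m C] is the matrix of the isomorphism
   sought. *)
pose W : 'M_(\rank I, n) := val_factmod (val_submod (1%:M : 'M_(\rank I))).
have sI : (val_submod (1%:M : 'M_(\rank I)) <= in_factmod V U)%MS.
  by rewrite val_submod1 genmxE.
have sWU : (W <= U)%MS.
  apply: submx_trans (_ : (val_factmod (in_factmod V U) <= U)%MS).
    by rewrite val_factmodS.
  rewrite (submx_trans (proj_factmodS V U)) //.
  by rewrite addsmx_sub sVU submx_refl.
have killV m (X : 'M_(m, n)) : (X <= V)%MS -> X *m C = 0.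
  by case/submxP=> D ->; rewrite -mulmxA VC mulmx0.
have projC m (X : 'M_(m, n)) : val_factmod (in_factmod V X) *m C = X *m C.
  rewrite -[in RHS](add_sub_fact_mod V X) mulmxDl [X in _ = X + _]killV ?add0r //.
  exact: val_submodP.
(* Since [B *m C = 1%:M], a combination of rows of [W] killed by [C] has no component along [B]; it
   lies in [V] and vanishes in the quotient. *)
have f_free : row_free (W *m C).
  apply/inj_row_free => x.
  rewrite mulmxA => xWC0.
  have /submxP[E def_xW] : (x *m W <= V + B)%MS.
    by rewrite (submx_trans _ UVB) // mulmx_sub.
  have : (x *m W <= V)%MS.
    have /sub_addsmxP[[u v] /= def_x] : (x *m W <= V + B)%MS.
      by rewrite (submx_trans _ UVB) // mulmx_sub.
    have v0 : v = 0.
      by move: xWC0; rewrite def_x mulmxDl -!mulmxA VC BC mulmx0 add0r mulmx1.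
    by rewrite def_x v0 mul0mx addr0 submxMl.
  rewrite -in_factmod_eq0 /W val_factmodE mulmxA -val_factmodE val_factmodK.
  by rewrite -val_submodE val_submod_eq0 => /eqP.
have f_full : row_full (W *m C).
  apply/row_fullP; exists (in_submod I (in_factmod V B)).
  have sB : (in_factmod V B <= I)%MS by rewrite genmxE submxMr.
  rewrite mulmxA /W val_factmodE mulmxA -val_factmodE -val_submodE.
  by rewrite in_submodK // projC.
exists (W *m C) => //.
  by rewrite -(eqP f_free) (eqP f_full).
move=> g Gg.
have WJ : section_repr modV modU g *m W = val_factmod (in_factmod V (W *m rG g)).
  rewrite /W val_factmodE mulmxA -val_factmodE -val_submodE.
  rewrite -[section_repr _ _ g]mul1mx val_submodJ //.
  by rewrite -val_factmodE; apply: val_factmodJ.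
rewrite mulmxA WJ projC.
have /submxP[E ->] := sWU.
by rewrite -!(mulmxA E) CJ // !mulmxA.
Qed.

End Sections.

(** * Chains of submodules with prescribed sections *)

Section Filtrations.

Variables (K : fieldType) (gT : finGroupType) (G : {group gT}).
Variable P : forall d, mx_representation K G d -> Prop.
Variables (n : nat) (rG : mx_representation K G n).

(** Chains grow upwards from [V]. The equality of row spaces in [chain_refl] allows one submodule to
    be given by different matrices. *)
Inductive chain (V : 'M[K]_n) : 'M[K]_n -> Prop :=
| chain_refl U of mxmodule rG U & (V :=: U)%MS : chain V U
| chain_step W U d (r : mx_representation K G d) of chain V W &
    mxmodule rG U & (W <= U)%MS & P r & is_section rG r W U : chain V U.

Lemma chain_eqmx V U U' : chain V U -> (U :=: U')%MS -> chain V U'.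
Proof.
case=> [W modW eVW eWU|W {}U d r VW modU sWU Pr sec eU].
  by apply: chain_refl (eqmx_trans eVW eWU); rewrite -(eqmx_module rG eWU).
apply: (chain_step VW _ _ Pr); rewrite -?(eqmx_module rG eU) -?eU //.
exact: is_section_eqmx sec.
Qed.

Lemma chain_trans V W U : chain V W -> chain W U -> chain V U.
Proof.
move=> VW; elim=> [{}U _ /(chain_eqmx VW) //|W' {}U d r _ IH modU sWU Pr sec].
exact: chain_step Pr sec.
Qed.

Lemma chain_eqmxl V V' U :
  (V :=: V')%MS -> mxmodule rG V' -> chain V' U -> chain V U.
Proof. by move=> eV modV; apply: chain_trans; apply: chain_refl. Qed.

Lemma chain1 V U d (r : mx_representation K G d) :
  mxmodule rG V -> mxmodule rG U -> (V <= U)%MS -> P r ->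
  is_section rG r V U -> chain V U.
Proof. by move=> modV modU; apply: chain_step => //; apply: chain_refl. Qed.

Lemma chain_module V U : chain V U -> mxmodule rG U.
Proof. by case. Qed.

Lemma chain_modulel V U : chain V U -> mxmodule rG V.
Proof. by elim=> // {}U modU eVU; rewrite (eqmx_module rG eVU). Qed.

(** Reverses the indexing: a chain is extended at its top, whereas a filtration is numbered from the
    whole module downwards. *)
Lemma chain_seq V U : chain V U ->
  exists (N : nat) (W : nat -> 'M[K]_n) (modW : forall i, mxmodule rG (W i)),
    [/\ (W 0%N :=: U)%MS, (W N :=: V)%MS,
        forall i, (i < N)%N -> (W i.+1 <= W i)%MS
      & forall i, (i < N)%N -> exists d (r : mx_representation K G d),
          P r /\ mx_rsim (section_repr (modW i.+1) (modW i)) r].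
Proof.
elim=> [{}U modU eVU|W {}U d r _ [N [X [modX [eX0 eXN sX secX]]]] modU sWU Pr sec].
  by exists 0%N, (fun=> U), (fun=> modU); split=> //; apply: eqmx_sym.
pose Y i := if i is j.+1 then X j else U.
have modY i : mxmodule rG (Y i) by case: i => [|i] /=.
exists N.+1, Y, modY; split=> // [[_|i lt_iN]|[_|i lt_iN]] /=.
- by rewrite eX0.
- exact: sX.
- exists d, r; split=> //; apply: section_rsim; rewrite /= ?eX0 //.
  exact: is_section_eqmx (eqmx_sym eX0) _ sec.
have [d' [r' [Pr' sim']]] := secX i lt_iN; exists d', r'; split=> //.
by apply: mx_rsim_trans sim'; apply: section_eqmx.
Qed.

End Filtrations.

(** * Annihilators and dual filtrations *)

Section ChainDual.

Variables (K : fieldType) (gT : finGroupType) (G : {group gT}).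
Variables (n : nat) (rG rG' : mx_representation K G n).
Hypothesis rG'E : forall g, g \in G -> rG' g = (rG g^-1%g)^T.

(** The linear forms vanishing on [U], where forms are row vectors through the standard dot
    product. *)
Definition annihilator (U : 'M[K]_n) : 'M[K]_n := kermx U^T.

Lemma sub_annihilator m (x : 'M_(m, n)) U :
  (x <= annihilator U)%MS = (x *m U^T == 0).
Proof. by rewrite /annihilator (sameP sub_kermxP eqP). Qed.

Lemma annihilator_mul (U : 'M_n) : annihilator U *m U^T = 0.
Proof. exact: mulmx_ker. Qed.

Lemma annihilatorS U V : (V <= U)%MS -> (annihilator U <= annihilator V)%MS.
Proof.
case/submxP=> D ->; rewrite sub_annihilator trmx_mul mulmxA annihilator_mul.
by rewrite mul0mx.
Qed.

Lemma annihilator_eqmx U V : (V :=: U)%MS -> (annihilator V :=: annihilator U)%MS.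
Proof. by move=> eUV; apply/eqmxP; rewrite !annihilatorS ?eUV. Qed.

Lemma annihilator_module U : mxmodule rG U -> mxmodule rG' (annihilator U).
Proof.
move=> modU; apply/mxmoduleP=> g Gg; rewrite rG'E // sub_annihilator.
have /submxP[D defUg] : (U *m rG g^-1%g <= U)%MS.
  by rewrite mxmodule_trans ?groupV.
by rewrite -mulmxA -trmx_mul defUg trmx_mul mulmxA annihilator_mul mul0mx.
Qed.

(** Transposition makes [C] and [B] exchange their roles. *)
Lemma is_section_dual d (r : mx_representation K G d) (V U : 'M_n) :
  mxmodule rG U -> is_section rG r V U ->
  is_section rG' (dual_repr r) (annihilator U) (annihilator V).
Proof.
move=> modU [C [B [VC BC BU UVB CJ]]]; exists B^T, C^T.
have /sub_addsmxP[[a b] /= defU] := UVB.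
have bUC : U *m C = b by rewrite defU mulmxDl -!mulmxA VC BC mulmx0 mulmx1 add0r.
have killV m (x : 'M_(m, n)) : annihilator V *m (x *m V)^T = 0.
  by rewrite trmx_mul mulmxA annihilator_mul mul0mx.
split.
- by case/submxP: BU => D ->; rewrite trmx_mul mulmxA annihilator_mul mul0mx.
- by rewrite -trmx_mul BC trmx1.
- by rewrite sub_annihilator -trmx_mul VC trmx0.
(* A form vanishing on [V] is determined on [U] by its values on [B]; the combination of the rows of
   [C^T] with these values agrees with it on [U], so the difference annihilates [U]. *)
- rewrite -[X in (X <= _)%MS](subrK (annihilator V *m B^T *m C^T)).
  rewrite addmx_sub_adds ?submxMl // sub_annihilator.
  move: (annihilator V) killV => X killV; rewrite mulmxBl -!mulmxA.
  rewrite -[C^T *m U^T]trmx_mul bUC [in X in X - _]defU linearD /= mulmxDr.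
  by rewrite killV add0r trmx_mul subrr.
move=> g Gg; rewrite rG'E // /= /dual_mx.
(* The action on the section is read off from the [B]-coordinates of [B *m rG g^-1%g] modulo [V]. *)
have Gg' : g^-1%g \in G by rewrite groupV.
have /submxP[D defB] := BU.
have /sub_addsmxP[[u v] /= defBg] : (B *m rG g^-1%g <= V + B)%MS.
  by rewrite (submx_trans _ UVB) // mxmodule_trans.
have -> : r g^-1%g = v.
  transitivity (B *m rG g^-1%g *m C).
    by rewrite defB -!(mulmxA D) CJ // !mulmxA -defB BC mul1mx.
  by rewrite defBg mulmxDl -!mulmxA VC BC mulmx0 mulmx1 add0r.
by rewrite -mulmxA -trmx_mul defBg linearD /= mulmxDr killV add0r trmx_mul mulmxA.
Qed.

Lemma chain_dual (P P' : forall d, mx_representation K G d -> Prop) V U :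
  (forall d (r : mx_representation K G d), P d r -> P' d (dual_repr r)) ->
  chain P rG V U -> chain P' rG' (annihilator U) (annihilator V).
Proof.
move=> PP'; elim=> [{}U modU eVU|W {}U d r VW IH modU sWU Pr sec].
  apply: chain_refl; last exact/annihilator_eqmx/eqmx_sym.
  by rewrite annihilator_module // (eqmx_module rG eVU).
apply: chain_trans IH; apply: (chain1 _ _ _ (PP' _ _ Pr)).
- exact: annihilator_module.
- exact/annihilator_module/(chain_module VW).
- exact: annihilatorS.
- exact: is_section_dual.
Qed.

End ChainDual.

(** * Outer tensor products of filtrations *)

Section ChainTensor.

Variables (K : fieldType) (gT1 gT2 : finGroupType).
Variables (G1 : {group gT1}) (G2 : {group gT2}) (n1 n2 : nat).
Variables (r1 : mx_representation K G1 n1) (r2 : mx_representation K G2 n2).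

Lemma tensmxDl m n p q (A B : 'M[K]_(m, n)) (C : 'M[K]_(p, q)) :
  (A + B) *t C = A *t C + B *t C.
Proof. by apply/matrixP=> i j; rewrite !mxE mulrDl. Qed.

Lemma tensmxDr m n p q (A : 'M[K]_(m, n)) (B C : 'M[K]_(p, q)) :
  A *t (B + C) = A *t B + A *t C.
Proof. by apply/matrixP=> i j; rewrite !mxE mulrDr. Qed.

Lemma tensmxS m1 m2 n p1 p2 q (A : 'M[K]_(m1, n)) (B : 'M[K]_(m2, n))
    (C : 'M[K]_(p1, q)) (D : 'M[K]_(p2, q)) :
  (A <= B)%MS -> (C <= D)%MS -> (A *t C <= B *t D)%MS.
Proof. by move=> /submxP[x ->] /submxP[y ->]; rewrite -tensmx_mul submxMl. Qed.

Lemma tensmx_addsl m1 m2 m3 n p q (A : 'M[K]_(m1, n)) (B : 'M[K]_(m2, n))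
    (C : 'M[K]_(m3, n)) (D : 'M[K]_(p, q)) :
  (A <= B + C)%MS -> (A *t D <= B *t D + C *t D)%MS.
Proof.
case/sub_addsmxP=> [[u v]] ->; rewrite tensmxDl addmx_sub_adds //;
  by rewrite tensmxS ?submxMl.
Qed.

Lemma tensmx_addsr m1 m2 m3 n p q (A : 'M[K]_(m1, n)) (B : 'M[K]_(m2, n))
    (C : 'M[K]_(m3, n)) (D : 'M[K]_(p, q)) :
  (A <= B + C)%MS -> (D *t A <= D *t B + D *t C)%MS.
Proof.
case/sub_addsmxP=> [[u v]] ->; rewrite tensmxDr addmx_sub_adds //;
  by rewrite tensmxS ?submxMl.
Qed.

Lemma tens1mx1 m p : (1%:M : 'M[K]_m) *t (1%:M : 'M[K]_p) = 1%:M.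
Proof.
apply/matrixP=> i j; case: (mxtens_indexP i) => i1 i2.
case: (mxtens_indexP j) => j1 j2; rewrite tensmxE !mxE -natrM mulnb.
by rewrite (inj_eq (can_inj (@mxtens_indexK _ _))) xpair_eqE.
Qed.

Lemma outer_module (A : 'M_n1) (B : 'M_n2) :
  mxmodule r1 A -> mxmodule r2 B -> mxmodule (outer_repr r1 r2) (A *t B).
Proof.
move=> modA modB; apply/mxmoduleP=> [[g h]] /setXP[Gg Gh] /=.
by rewrite /outer_mx tensmx_mul tensmxS // mxmodule_trans.
Qed.

(** The tensor products of the two pairs of witnesses serve, as the section is the product of U1/V1
    and U2/V2: the summand [V1 *t 1%:M] absorbs every term whose first factor lies in [V1]. *)
Lemma is_section_tensor d1 d2 (s1 : mx_representation K G1 d1)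
    (s2 : mx_representation K G2 d2) (V1 U1 : 'M_n1) (V2 U2 : 'M_n2) :
  mxmodule r1 V1 -> is_section r1 s1 V1 U1 -> is_section r2 s2 V2 U2 ->
  is_section (outer_repr r1 r2) (outer_repr s1 s2)
    (V1 *t 1%:M + U1 *t V2)%MS (V1 *t 1%:M + U1 *t U2)%MS.
Proof.
move=> modV1 [C1 [B1 [VC1 BC1 BU1 UVB1 CJ1]]] [C2 [B2 [VC2 BC2 BU2 UVB2 CJ2]]].
exists (C1 *t C2), (B1 *t B2); split.
- apply/eqP; rewrite -submx0 addsmxMr addsmx_sub !tensmx_mul VC1 VC2.
  by rewrite tens0mx tensmx0 !sub0mx.
- by rewrite tensmx_mul BC1 BC2 tens1mx1.
- by rewrite (submx_trans _ (addsmxSr _ _)) // tensmxS.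
- rewrite addsmx_sub (submx_trans (addsmxSl _ _) (addsmxSl _ _)) /=.
  apply: submx_trans (tensmx_addsl _ UVB1) _; rewrite addsmx_sub; apply/andP; split.
    apply: submx_trans (_ : (V1 *t 1%:M <= _)%MS); first by rewrite tensmxS ?submx1.
    exact: submx_trans (addsmxSl _ _) (addsmxSl _ _).
  apply: submx_trans (tensmx_addsr _ UVB2) _; apply: addsmxS => //.
  by apply: submx_trans (addsmxSr _ _); rewrite tensmxS.
move=> [g h] /setXP[Gg Gh]; rewrite /= /outer_mx /=.
have /sub_addsmxP[[u v] /= ->] := submx_refl (V1 *t 1%:M + U1 *t U2)%MS.
rewrite !mulmxDl -!mulmxA !tensmx_mul !mulmxA.
have /submxP[D ->] : (V1 *m r1 g <= V1)%MS by rewrite mxmodule_trans.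
by rewrite -[D *m V1 *m C1]mulmxA VC1 mulmx0 !mul0mx !tens0mx CJ1 // CJ2.
Qed.

Variable P1 : forall d, mx_representation K G1 d -> Prop.
Variable P2 : forall d, mx_representation K G2 d -> Prop.
Variable P : forall d, mx_representation K (setX_group G1 G2) d -> Prop.
Hypothesis P12 : forall d1 d2 (s1 : mx_representation K G1 d1)
  (s2 : mx_representation K G2 d2), P1 s1 -> P2 s2 -> P (outer_repr s1 s2).

(** Each step from [W] to [U] of the first chain is refined by the modules [W *t 1%:M + U *t V'],
    where [V'] runs through the second chain. *)
Lemma chain_tensor : chain P1 r1 0 1%:M -> chain P2 r2 0 1%:M ->
  chain P (outer_repr r1 r2) 0 1%:M.
Proof.
move=> ch1 ch2; have mod1 := @mxmodule1 _ _ _ _ r2.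
suff ch V U : chain P1 r1 V U ->
    chain P (outer_repr r1 r2) (V *t 1%:M) (U *t 1%:M).
  by have := ch _ _ ch1; rewrite tens0mx tens1mx1.
elim=> [{}U modU eVU|W {}U d s VW IH modU sWU Ps sec].
  apply: chain_refl; first exact: outer_module.
  by apply/eqmxP; rewrite !tensmxS ?eVU.
apply: chain_trans IH _; have modW := chain_module VW.
suff ch' V' U' : chain P2 r2 V' U' ->
    chain P (outer_repr r1 r2) (W *t 1%:M + U *t V')%MS (W *t 1%:M + U *t U')%MS.
  have := ch' _ _ ch2; rewrite tensmx0 => ch''.
  apply: (chain_eqmxl _ _ (chain_eqmx ch'' _)).
  - exact/eqmx_sym/addsmx0.
  - by rewrite (eqmx_module _ (addsmx0 _ _)) outer_module.
  - by apply/addsmx_idPr; rewrite tensmxS.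
have modX (A : 'M_n2) : mxmodule r2 A ->
    mxmodule (outer_repr r1 r2) (W *t 1%:M + U *t A)%MS.
  by move=> modA; apply: addsmx_module; apply: outer_module.
elim=> [{}U' modU' eVU'|W' {}U' d' s' VW' IH' modU' sWU' Ps' sec'].
  apply: chain_refl; first exact: modX.
  by apply: adds_eqmx => //; apply/eqmxP; rewrite !tensmxS ?eVU'.
apply: chain_trans IH' _; have modW' := chain_module VW'.
apply: (chain1 _ _ _ (P12 Ps Ps')); rewrite ?modX //; last exact: is_section_tensor.
by rewrite addsmxS // tensmxS.
Qed.

End ChainTensor.

(** * Fillings of Young diagrams *)

Lemma leq_sum_eq (I : finType) (f g : I -> nat) : (forall x, f x <= g x)%N ->
  (\sum_x g x <= \sum_x f x)%N -> f =1 g.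
Proof.
move=> le_fg le_sum x; apply/eqP; rewrite eqn_leq le_fg leqNgt; apply/negP => lt_x.
move: le_sum; apply/negP; rewrite -ltnNge (bigD1 x) // [X in (_ < X)%N](bigD1 x) //=.
by rewrite -addSn leq_add ?leq_sum.
Qed.

Section Fillings.

Variable n : nat.
Implicit Types (c r F : 'I_n -> nat) (g h s : 'S_n).

Definition color_stab c : {set 'S_n} := [set s : 'S_n | [forall x, c (s x) == c x]].

Lemma color_stabP c s : reflect (forall x, c (s x) = c x) (s \in color_stab c).
Proof. by rewrite inE; apply: (iffP forallP) => cs x; apply/eqP; rewrite ?cs. Qed.

Lemma color_stab_group_set c : group_set (color_stab c).
Proof.
apply/group_setP; split=> [|s t /color_stabP cs /color_stabP ct].
  by apply/color_stabP=> x; rewrite perm1.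
by apply/color_stabP=> x; rewrite permM ct cs.
Qed.
Canonical color_stab_group c := Group (color_stab_group_set c).

Definition weakly_increasing (k o F : 'I_n -> nat) :=
  forall x y, k x = k y -> (o x < o y)%N -> (F x <= F y)%N.

Definition strictly_increasing (k o F : 'I_n -> nat) :=
  forall x y, k x = k y -> (o x < o y)%N -> (F x < F y)%N.

Definition jointly_injective (r c : 'I_n -> nat) :=
  forall x y, r x = r y -> c x = c y -> x = y.

Lemma strictly_weakly k o F : strictly_increasing k o F -> weakly_increasing k o F.
Proof. by move=> incF x y kxy oxy; apply/ltnW/incF. Qed.

(** On each class of [k] the values of [F] and of [F \o g] form the same multiset and are both
    sorted along [o]; a sorted list is determined by its multiset. *)
Lemma sorted_unique (k o F : 'I_n -> nat) g :
  jointly_injective k o -> g \in color_stab k ->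
  weakly_increasing k o F -> weakly_increasing k o (F \o g) -> F \o g =1 F.
Proof.
move=> inj_ko /color_stabP kg incF incFg x.
pose s := sort (relpre o leq) (enum [pred y | k y == k x]).
have mem_s y : (y \in s) = (k y == k x) by rewrite mem_sort mem_enum.
have sortedF (F' : 'I_n -> nat) : weakly_increasing k o F' -> sorted leq (map F' s).
  move=> incF'; rewrite sorted_map.
  apply: (@sub_in_sorted _ (mem s) (relpre o leq)).
  - move=> y z; rewrite /= !mem_s => /eqP ky /eqP kz.
    rewrite leq_eqVlt => /orP[/eqP oyz|]; last by apply: incF'; rewrite ky.
    by rewrite (inj_ko y z) ?ky.
  - by apply/allP.
  - by apply: sort_sorted => y z; apply: leq_total.
have /eq_in_map eqFs : [seq (F \o g) y | y <- s] = [seq F y | y <- s].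
  apply: (sorted_eq leq_trans anti_leq); try exact: sortedF.
  rewrite (map_comp F g) -[X in perm_eq _ X]/(map F s); apply: perm_map.
  apply: uniq_perm.
  - by rewrite map_inj_uniq ?sort_uniq ?enum_uniq //; apply: perm_inj.
  - by rewrite sort_uniq enum_uniq.
  move=> y; rewrite mem_s; apply/mapP/eqP => [[z]|ky].
    by rewrite mem_s => /eqP kz ->; rewrite kg.
  by exists (g^-1%g y); rewrite ?permKV // mem_s -ky -[in X in _ == X](permKV g y) kg.
by apply: eqFs; rewrite mem_s.
Qed.

Definition score r F : nat := (\sum_x r x * F x)%N.

(* Swapping a descent of [F \o h] raises the score. *)
Lemma max_score_sorted r c F h : h \in color_stab c ->
  (forall h', h' \in color_stab c -> (score r (F \o h') <= score r (F \o h))%N) ->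
  weakly_increasing c r (F \o h).
Proof.
move=> /[dup] ch /color_stabP hc max_h x y cxy rxy; rewrite leqNgt; apply/negP => /= ltF.
have nexy : y != x by apply: contraTneq rxy => ->; rewrite ltnn.
pose h' := (tperm x y * h)%g.
have ch' : h' \in color_stab c.
  rewrite groupM //; apply/color_stabP=> z.
  by case: tpermP => [->|->|].
have := max_h _ ch'; apply/negP; rewrite -ltnNge.
rewrite /score (bigD1 x) // (bigD1 y) //= [X in (_ < X)%N](bigD1 x) //.
rewrite [X in (_ < _ + X)%N](bigD1 y) //= !permM tpermL tpermR !addnA.
have -> : (\sum_(i | (i != x) && (i != y)) r i * F (h' i) =
           \sum_(i | (i != x) && (i != y)) r i * F (h i))%N.
  by apply: eq_bigr => i /andP[ix iy]; rewrite permM tpermD // eq_sym.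
rewrite ltn_add2r; nia.
Qed.

Lemma exists_sorted r c F :
  exists2 h, h \in color_stab c & weakly_increasing c r (F \o h).
Proof.
have c1 : 1%g \in color_stab c by exact: group1.
case: (arg_maxnP (fun h => score r (F \o h)) c1) => h ch max_h.
by exists h => //; apply: max_score_sorted.
Qed.

(** A rearrangement of maximal score is sorted in every column, and by strictness only the identity
    is; so the maximum is attained at the identity alone. *)
Lemma strict_score r c F h :
  jointly_injective r c -> strictly_increasing c r F -> h \in color_stab c ->
  (score r (F \o h) <= score r F)%N /\ (score r (F \o h) = score r F -> h = 1%g).
Proof.
move=> inj_rc incF ch.
have inj_cr : jointly_injective c r by move=> x y cxy rxy; apply: inj_rc.
have sorted1 g : g \in color_stab c -> weakly_increasing c r (F \o g) -> g = 1%g.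
  move=> cg /(sorted_unique inj_cr cg (strictly_weakly incF)) eqF.
  apply/permP=> x; rewrite perm1.
  have cgx : c (g x) = c x by exact/color_stabP.
  apply: inj_rc => //; have /= eFx := eqF x.
  by case: (ltngtP (r (g x)) (r x)) => // /incF; rewrite cgx eFx ltnn => /(_ erefl).
have c1 : 1%g \in color_stab c by exact: group1.
case: (arg_maxnP (fun h => score r (F \o h)) c1) => g cg max_g.
have g1 : g = 1%g by apply: (sorted1 _ cg); apply: (max_score_sorted cg).
have E : score r (F \o (1%g : 'S_n)) = score r F.
  by apply: eq_bigr => x _; rewrite /= perm1.
have le_h h' : h' \in color_stab c -> (score r (F \o h') <= score r F)%N.
  by move=> /max_g; rewrite g1 E.
split=> [|eq_h]; first exact: le_h.
by apply: sorted1 => //; apply: max_score_sorted => // h' /le_h; rewrite eq_h.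
Qed.

(** The usual Garnir belt along two columns, for a descent between [x0] and [y0] in one row. *)
Definition garnir_set r c x0 y0 : {set 'I_n} :=
  [set z | (c z == c x0) && (r x0 <= r z)%N]
  :|: [set z | (c z == c y0) && (r z <= r y0)%N].

(** When [c] stays below [n], the colour [n] is fresh, and the stabilizer permutes the Garnir set
    freely and the other boxes within their columns. *)
Definition garnir_coloring r c x0 y0 (z : 'I_n) : nat :=
  if z \in garnir_set r c x0 y0 then n else c z.

Lemma garnir_score r c F x0 y0 g :
  r x0 = r y0 -> (c x0 < c y0)%N -> (F y0 < F x0)%N ->
  strictly_increasing c r F -> jointly_injective r c ->
  perm_on (garnir_set r c x0 y0) g ->
  g \notin color_stab c -> (score c F < score (c \o g) F)%N.
Proof.
set X := garnir_set r c x0 y0 => rxy cxy Fxy incF inj_rc gX gc.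
have incF' x y : c x = c y -> (r x <= r y)%N -> (F x <= F y)%N.
  move=> cxy'; rewrite leq_eqVlt => /orP[/eqP rxy'|/(incF _ _ cxy')/ltnW //].
  by rewrite (inj_rc x y).
have memX z : (z \in X) = ((c z == c x0) && (r x0 <= r z)%N)
    || ((c z == c y0) && (r z <= r y0)%N).
  by rewrite !inE.
(* A box that changes column moves to the right from the left part of the Garnir
   set, where 2 F > th, and to the left from its right part, where 2 F < th. *)
pose th := (F x0 + F y0)%N.
have le_z z : (2 * (c z * F z) + c (g z) * th <= 2 * (c (g z) * F z) + c z * th)%N
   /\ (c (g z) != c z ->
       2 * (c z * F z) + c (g z) * th < 2 * (c (g z) * F z) + c z * th)%N.
  case: (boolP (z \in X)) => [Xz|/(out_perm gX) ->]; last by split; rewrite ?eqxx.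
  have := Xz; rewrite -(perm_closed z gX) !memX => Xgz.
  rewrite /th; move: Xz; rewrite memX; case/orP=> /andP[/eqP cz rz].
    have Fz : (F x0 <= F z)%N by apply: incF'.
    have cgz : (c x0 <= c (g z))%N by case/orP: Xgz => /andP[/eqP -> _] //; apply: ltnW.
    rewrite cz; split; first nia.
    by rewrite neq_ltn ltnNge cgz /=; nia.
  have Fz : (F z <= F y0)%N by apply: incF'.
  have cgz : (c (g z) <= c y0)%N by case/orP: Xgz => /andP[/eqP -> _] //; apply: ltnW.
  rewrite cz; split; first nia.
  by rewrite neq_ltn orbC ltnNge cgz /=; nia.
have [z0 cz0] : exists z, c (g z) != c z.
  apply/existsP; apply: contraR gc; rewrite negb_exists => /forallP cg.
  by apply/color_stabP => z; apply/eqP; rewrite -[_ == _]negbK.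
have : (\sum_z (2 * (c z * F z) + c (g z) * th)
        < \sum_z (2 * (c (g z) * F z) + c z * th))%N.
  rewrite (bigD1 z0) // [X in (_ < X)%N](bigD1 z0) //= -addSn leq_add //.
    exact: (proj2 (le_z z0)).
  by apply: leq_sum => z _; case: (le_z z).
have E (c1 c2 : 'I_n -> nat) : (\sum_z (2 * (c1 z * F z) + c2 z * th)
    = 2 * score c1 F + (\sum_z c2 z) * th)%N.
  by rewrite big_split big_distrl big_distrr.
rewrite (E c (c \o g)) (E (c \o g) c).
have -> : (\sum_i (c \o g) i = \sum_i c i)%N.
  by rewrite [RHS](reindex_inj (@perm_inj _ g)).
by rewrite ltn_add2r ltn_mul2l.
Qed.

End Fillings.

(** * Diagrams and the weight of a colouring *)

Section Diagrams.

Variable n : nat.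
Implicit Types c r F : 'I_n -> nat.

Definition color_class c (j : nat) : {set 'I_n} := [set x | c x == j].

(* Colours range over [0, ..., n], so that the colouring of the columns of a
   tableau with [n] boxes leaves the colour [n] free. With powers of 2, merging
   [p + 1] boxes outweighs the loss of two columns with at most [p] boxes, and
   [2 ^ p - 1] is the sum of the [2 ^ i] over the row numbers [i] in a column. *)
Definition weight c : nat := (\sum_(j < n.+1) (2 ^ #|color_class c j|).-1)%N.

Definition diagram r c := jointly_injective r c /\
  forall x i j, (i <= r x)%N -> (j <= c x)%N -> exists2 y, r y = i & c y = j.

Lemma card_le_values (f : 'I_n -> nat) (P Q : {set 'I_n}) : {in P &, injective f} ->
  (forall z, z \in P -> exists2 z', z' \in Q & f z' = f z) -> (#|P| <= #|Q|)%N.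
Proof.
move=> inj_f PQ; rewrite !cardE -(size_map f (enum P)) -(size_map f (enum Q)).
apply: uniq_leq_size.
  by rewrite map_inj_in_uniq ?enum_uniq // => x y; rewrite !mem_enum; apply: inj_f.
move=> w /mapP[z]; rewrite mem_enum => /PQ[z' Qz' <-] ->.
by apply: map_f; rewrite mem_enum.
Qed.

Section OneDiagram.

Variables r c : 'I_n -> nat.
Hypothesis rc : diagram r c.

Lemma diagram_col_inj j : {in color_class c j &, injective r}.
Proof.
by move=> x y; rewrite !inE => /eqP cx /eqP cy rxy; apply: (proj1 rc); rewrite ?cx.
Qed.

Lemma diagram_col_lt x : (c x < n)%N.
Proof.
rewrite -[X in (_ < X)%N](size_enum_ord n) -(size_map c) -[X in (X <= _)%N](size_iota 0).
apply: uniq_leq_size (iota_uniq _ _) _ => j; rewrite mem_iota /= add0n ltnS => lejx.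
have [y _ <-] := proj2 rc x _ _ (leqnn _) lejx.
by rewrite map_f ?mem_enum.
Qed.

Lemma strictly_increasing_ge F x : strictly_increasing c r F -> (r x <= F x)%N.
Proof.
move=> incF; have [m] := ubnP (r x); elim: m x => // m IH x.
case def_i: (r x) => [|i] // lt_im.
have [||y ry cy] := proj2 rc x i (c x); rewrite ?def_i //.
apply: leq_ltn_trans (incF y x cy _); last by rewrite ry def_i.
by rewrite -ry IH // ry.
Qed.

(** A box brings with it all boxes above it in its column, so no row number in the column reaches
    the size of the column. *)
Lemma diagram_col_rows j :
  perm_eq [seq r x | x in color_class c j] (iota 0 #|color_class c j|).
Proof.
set s := [seq _ | _ in _].
have s_uniq : uniq s.
  rewrite map_inj_in_uniq ?enum_uniq // => x y; rewrite !mem_enum.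
  exact: diagram_col_inj.
have sz_s : size s = #|color_class c j| by rewrite size_map cardE.
apply: uniq_perm; rewrite ?iota_uniq //.
apply: (uniq_min_size s_uniq _ _).2; last by rewrite size_iota sz_s.
move=> w /mapP[x]; rewrite mem_enum inE => /eqP cx ->.
rewrite mem_iota /= add0n -sz_s.
rewrite -[X in (X <= _)%N](size_iota 0); apply: uniq_leq_size (iota_uniq _ _) _ => i.
rewrite mem_iota /= add0n ltnS => leix.
have [y <- cy] := proj2 rc x i (c x) leix (leqnn _).
by apply: map_f; rewrite mem_enum inE cy cx.
Qed.

(** Expresses the weight through the rows alone, so that it can be compared with the row numbers of
    a tabloid. *)
Lemma diagram_weight : (\sum_x 2 ^ r x)%N = weight c.
Proof.
have c_lt x : (c x < n.+1)%N by rewrite ltnW ?ltnS ?diagram_col_lt.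
rewrite (partition_big (fun x => Ordinal (c_lt x)) xpredT) //=.
apply: eq_bigr => j _; rewrite predn_exp mul1n.
transitivity (\sum_(i <- [seq r x | x in color_class c j]) 2 ^ i)%N.
  rewrite big_map big_enum /=; apply: eq_bigl => x.
  by rewrite inE -val_eqE.
by rewrite (perm_big _ (diagram_col_rows j)) -[X in iota 0 X]subn0 big_mkord.
Qed.

(** The Garnir set has more boxes than the column of [x0], which is at least as long as that of
    [y0], and the classes of the other columns do not change. *)
Lemma garnir_weight x0 y0 : r x0 = r y0 -> (c x0 < c y0)%N ->
  (weight c < weight (garnir_coloring r c x0 y0))%N.
Proof.
move=> rxy cxy; set c' := garnir_coloring _ _ _ _.
pose A := [set z | (c z == c x0) && (r x0 <= r z)%N].
pose B := [set z | (c z == c y0) && (r z <= r y0)%N].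
pose X := A :|: B.
have memX z : (z \in X) = (z \in A) || (z \in B) by rewrite inE.
have memA z : z \in A = ((c z == c x0) && (r x0 <= r z)%N) by rewrite inE.
have memB z : z \in B = ((c z == c y0) && (r z <= r y0)%N) by rewrite inE.
have cardX : (#|color_class c (c x0)| < #|X|)%N.
  pose D := [set z | (c z == c x0) && (r z < r x0)%N].
  have -> : #|color_class c (c x0)| = (#|A| + #|D|)%N.
    rewrite -cardsUI (_ : A :&: D = set0) ?cards0 ?addn0.
      congr #|pred_of_set _|; apply/setP=> z.
      by rewrite !inE -andb_orr; case: ltnP; rewrite ?andbT.
    by apply/setP=> z; rewrite !inE ltnNge; case: (c z == c x0) => //=; case: leqP.
  have -> : #|X| = (#|A| + #|B|)%N.
    rewrite -cardsUI (_ : A :&: B = set0) ?cards0 ?addn0 //.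
    apply/setP=> z; rewrite !inE; case: eqP => //= ->.
    by rewrite (ltn_eqF cxy) andbF.
  have x0D : x0 \notin D by rewrite inE ltnn andbF.
  (* The boxes of the column of [x0] down to [x0] itself are matched row by row with boxes of [B],
     because [x0] and [y0] are in the same row. *)
  rewrite ltn_add2l -[X in (X <= _)%N]/(true + _)%N -{1}x0D -cardsU1.
  apply: (@card_le_values r) => [x y|z].
    have mem_x0 z : z \in x0 |: D -> z \in color_class c (c x0).
      by rewrite !inE => /orP[/eqP -> //|/andP[]].
    by move=> /mem_x0 x_in /mem_x0; apply: diagram_col_inj.
  rewrite !inE => z_in.
  have rz : (r z <= r y0)%N.
    by rewrite -rxy; case/orP: z_in => [/eqP -> //|/andP[_ /ltnW]].
  have [y ry cy] := proj2 rc y0 (r z) (c y0) rz (leqnn _).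
  by exists y; rewrite // memB cy ry eqxx.
have cardY : (#|color_class c (c y0)| <= #|color_class c (c x0)|)%N.
  apply: (@card_le_values r) => [|z]; first exact: diagram_col_inj.
  rewrite inE => /eqP cz.
  have [||y ry cy] := proj2 rc z (r z) (c x0); rewrite ?cz ?(ltnW cxy) //.
  by exists y; rewrite // inE cy.
have c_lt x : (c x < n.+1)%N by rewrite ltnW ?ltnS ?diagram_col_lt.
pose jx := Ordinal (c_lt x0); pose jy := Ordinal (c_lt y0).
have nejx : jx != ord_max by rewrite -val_eqE /= ltn_eqF ?diagram_col_lt.
have nejy : jy != ord_max by rewrite -val_eqE /= ltn_eqF ?diagram_col_lt.
have nejyx : jy != jx by rewrite -val_eqE /= gtn_eqF.
have classn : color_class c n = set0.
  by apply/setP=> z; rewrite !inE ltn_eqF ?diagram_col_lt.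
have classn' : color_class c' n = X.
  apply/setP=> z; rewrite [LHS]inE /c' /garnir_coloring -/X.
  case: (z \in X); first exact: eqxx.
  by rewrite ltn_eqF ?diagram_col_lt.
rewrite /weight (bigD1 ord_max) //= (bigD1 jx) //= (bigD1 jy) ?nejyx ?nejy //=.
rewrite [X in (_ < X)%N](bigD1 ord_max) //= [X in (_ < _ + X)%N](bigD1 jx) //=.
rewrite [X in (_ < _ + (_ + X))%N](bigD1 jy) ?nejyx ?nejy //= classn classn' cards0.
rewrite add0n !addnA -addSn leq_add //.
  (* What remains of the two columns is dropped from the new weight. If they had p and q boxes with
     q <= p, then 2^p - 1 + 2^q - 1 < 2^(p+1) - 1 is enough. *)
  rewrite -!addnA (leq_trans _ (leq_addr _ _)) //.
  apply: leq_trans (_ : (2 ^ (#|color_class c (c x0)|).+1).-1 <= _)%N; last first.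
    by rewrite -!subn1 leq_sub2r // leq_pexp2l.
  have le2 : (2 ^ #|color_class c (c y0)| <= 2 ^ #|color_class c (c x0)|)%N.
    by rewrite leq_pexp2l.
  have p_gt0 : (0 < 2 ^ #|color_class c (c y0)|)%N by rewrite expn_gt0.
  rewrite expnS; move: (2 ^ _)%N (2 ^ _)%N le2 p_gt0 => p q; lia.
apply: leq_sum => j /andP[/andP[nejn nej_x] nej_y].
suff -> : color_class c' j = color_class c j by [].
apply/setP=> z; rewrite [LHS]inE [RHS]inE /c' /garnir_coloring -/X; case: ifP => // Xz.
have -> : (n == j :> nat) = false by apply/negbTE; rewrite eq_sym.
symmetry; apply/negbTE; move: Xz; rewrite memX memA memB.
by case/orP=> /andP[/eqP -> _]; rewrite eq_sym.
Qed.

End OneDiagram.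

End Diagrams.

Lemma parts_inj n : injective (@parts n).
Proof.
case=> s sP [s' s'P] /= eqs; case: _ / eqs s'P => s'P.
by rewrite (bool_irrelevance sP s'P).
Qed.

(** * Tableaux and tabloids as row and column functions *)

Section TableauDiagram.

Variables (n : nat) (lam : intpart n).
Implicit Types (t u : tableau lam) (b : box lam) (A B : tabloid lam) (s : 'S_n).

Lemma box_inj b b' : box_row b = box_row b' -> box_col b = box_col b' -> b = b'.
Proof.
case: b b' => [i j] [k l]; rewrite /box_row /box_col /= => /val_inj Eik Ejl.
by case: _ / Eik l Ejl => l /val_inj ->.
Qed.

Lemma box_exists i j : (j < nth 0%N lam i)%N ->
  exists2 b : box lam, box_row b = i & box_col b = j.
Proof.
move=> lt_j; have lt_i : (i < size lam)%N.
  by rewrite ltnNge; apply: contraTN lt_j => /(nth_default 0%N) ->.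
pose col : 'I_(nth 0%N lam (Ordinal lt_i)) := Ordinal lt_j.
by exists (Tagged (fun i : 'I_(size lam) => 'I_(nth 0%N lam i)) col).
Qed.

Lemma box_col_lt b : (box_col b < nth 0%N lam (box_row b))%N.
Proof. exact: ltn_ord. Qed.

Lemma parts_nonincreasing i i' : (i <= i')%N -> (nth 0%N lam i' <= nth 0%N lam i)%N.
Proof.
have /and3P[lam_sorted _ _] := partsP lam; move=> lei.
case: (ltnP i' (size lam)) => [lti'|]; last by move=> /(nth_default 0%N) ->.
apply: (sorted_leq_nth _ _ 0%N lam_sorted) => //; last 1 first.
- by rewrite inE (leq_ltn_trans lei).
- by move=> x y z /= yx zx; apply: leq_trans yx.
- exact: leqnn.
Qed.

Lemma tableau_inj t : injective (val t).
Proof. exact/injectiveP/(valP t). Qed.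

Lemma tableau_surj t (x : 'I_n) : exists b, val t b = x.
Proof.
have [|t' tK t'K] := inj_card_bij (@tableau_inj t); first by rewrite card_ord card_box.
by exists (t' x).
Qed.

(** The default 0 never occurs, here or in [tab_col], because every [x] fills a box by
    [tableau_surj]. *)
Definition tab_row t (x : 'I_n) : nat :=
  odflt 0%N (omap (@box_row n lam) [pick b | val t b == x]).
Definition tab_col t (x : 'I_n) : nat :=
  odflt 0%N (omap (@box_col n lam) [pick b | val t b == x]).

Lemma tab_rowE t b : tab_row t (val t b) = box_row b.
Proof.
rewrite /tab_row; case: pickP => [b' /eqP/tableau_inj -> //|/(_ b)].
by rewrite eqxx.
Qed.

Lemma tab_colE t b : tab_col t (val t b) = box_col b.
Proof.
rewrite /tab_col; case: pickP => [b' /eqP/tableau_inj -> //|/(_ b)].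
by rewrite eqxx.
Qed.

Lemma tab_diagram t : diagram (tab_row t) (tab_col t).
Proof.
split=> [x y|x i j].
  have [[b <-] [b' <-]] := (tableau_surj t x, tableau_surj t y).
  by rewrite !tab_rowE !tab_colE => rb cb; rewrite (box_inj rb cb).
have [b <-] := tableau_surj t x; rewrite tab_rowE tab_colE => lei lej.
have [|b' rb' cb'] := @box_exists i j.
  exact: leq_ltn_trans lej (leq_trans (box_col_lt b) (parts_nonincreasing lei)).
by exists (val t b'); rewrite ?tab_rowE ?tab_colE.
Qed.

Lemma mem_row_set t i x : (x \in row_set t i) = (tab_row t x == i).
Proof.
have [b <-] := tableau_surj t x; rewrite tab_rowE mem_imset ?inE //.
exact: tableau_inj.
Qed.

Lemma mem_col_set t i x : (x \in col_set t i) = (tab_col t x == i).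
Proof.
have [b <-] := tableau_surj t x; rewrite tab_colE mem_imset ?inE //.
exact: tableau_inj.
Qed.

Lemma row_equivE t u : reflect (tab_row t =1 tab_row u) (row_equiv t u).
Proof.
apply: (iffP forallP) => [eq_row x|eq_row b].
  have [b <-] := tableau_surj t x; have /eqP/setP/(_ (val t b)) := eq_row b.
  by rewrite !mem_row_set tab_rowE eqxx => /esym/eqP.
by apply/eqP/setP=> x; rewrite !mem_row_set eq_row.
Qed.

Lemma tabloid_of_eq t u : tab_row t =1 tab_row u <-> tabloid_of t = tabloid_of u.
Proof.
split=> [eq_row|/(congr1 val)/= /setP/(_ u)].
  apply: val_inj; apply/setP=> v; rewrite !inE.
  by apply/row_equivE/row_equivE => eqv x; rewrite -eqv eq_row.
by rewrite !inE => eqtu; apply/row_equivE; rewrite eqtu; apply/row_equivE.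
Qed.

Lemma tabloid_of_surj A : exists t, A = tabloid_of t.
Proof. by have /imsetP[t _ At] := valP A; exists t; apply: val_inj. Qed.

(** Encodes a tabloid by the row of each entry, which determines it; the default does not occur, as
    every tabloid comes from a tableau. *)
Definition tabloid_row A (x : 'I_n) : nat :=
  odflt 0%N (omap (tab_row^~ x) [pick t | tabloid_of t == A]).

Lemma tabloid_rowE t : tabloid_row (tabloid_of t) =1 tab_row t.
Proof.
move=> x; rewrite /tabloid_row; case: pickP => [u /eqP/tabloid_of_eq eq_row|/(_ t)].
  exact: eq_row.
by rewrite eqxx.
Qed.

Lemma tabloid_row_inj A B : tabloid_row A =1 tabloid_row B -> A = B.
Proof.
have [[t ->] [u ->]] := (tabloid_of_surj A, tabloid_of_surj B) => eqAB.
by apply/tabloid_of_eq => x; rewrite -!tabloid_rowE.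
Qed.

Lemma tab_row_act t s x : tab_row (tableau_act lam t s) x = tab_row t (s^-1%g x).
Proof.
apply/esym/eqP; rewrite -mem_row_set -(mem_imset _ _ (@perm_inj _ s)) permKV.
by rewrite -row_set_act mem_row_set.
Qed.

Lemma tabloid_row_act A s x :
  tabloid_row (tabloid_act lam A s) x = tabloid_row A (s^-1%g x).
Proof.
by have [t ->] := tabloid_of_surj A; rewrite tabloid_of_act !tabloid_rowE tab_row_act.
Qed.

Lemma tabloid_trans A B : exists s, B = tabloid_act lam A s.
Proof.
have [[t ->] [u ->]] := (tabloid_of_surj A, tabloid_of_surj B).
by have [s ->] := tableau_trans t u; exists s; rewrite tabloid_of_act.
Qed.

Lemma col_stabE t : col_stab t = color_stab (tab_col t).
Proof.
apply/setP=> s; rewrite inE; apply/forallP/color_stabP => [st x|st b].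
  have [b <-] := tableau_surj t x; rewrite tab_colE.
  by apply/eqP; rewrite -mem_col_set -(eqP (st b)) imset_f // mem_col_set tab_colE.
rewrite eqEcard card_imset ?leqnn ?andbT; last exact: perm_inj.
by apply/subsetP=> y /imsetP[x]; rewrite mem_col_set => xb ->; rewrite mem_col_set st.
Qed.

Lemma card_tab_row t i : #|[set x | tab_row t x == i]| = nth 0%N lam i.
Proof.
have inj_c : {in [set x | tab_row t x == i] &, injective (tab_col t)}.
  move=> x y; rewrite !inE => /eqP rx /eqP ry cxy.
  by apply: (proj1 (tab_diagram t)); rewrite ?rx.
rewrite cardE -(size_map (tab_col t)) -(size_iota 0 (nth 0%N lam i)).
apply/perm_size/uniq_perm; rewrite ?iota_uniq //.
  by rewrite map_inj_in_uniq ?enum_uniq // => x y; rewrite !mem_enum; apply: inj_c.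
move=> j; rewrite mem_iota /= add0n; apply/mapP/idP => [[x]|lt_j].
  rewrite mem_enum inE => rx ->; move: rx; have [b <-] := tableau_surj t x.
  by rewrite tab_rowE tab_colE => /eqP <-; apply: box_col_lt.
have [b rb cb] := box_exists lt_j; exists (val t b); last by rewrite tab_colE.
by rewrite mem_enum inE tab_rowE rb.
Qed.

End TableauDiagram.

(** Counting the entries in each row recovers the parts, and the absence of zero parts recovers the
    length. *)
Lemma tabloid_row_shape n (lam lam' : intpart n) (A : tabloid lam) (A' : tabloid lam') :
  tabloid_row A =1 tabloid_row A' -> lam = lam'.
Proof.
have [[t ->] [u ->]] := (tabloid_of_surj A, tabloid_of_surj A') => eq_row.
have eq_nth i : nth 0%N lam i = nth 0%N lam' i.
  rewrite -(card_tab_row t) -(card_tab_row u); congr #|pred_of_set _|.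
  by apply/setP=> x; rewrite !inE -!tabloid_rowE eq_row.
have le_size (nu nu' : intpart n) : (forall i, nth 0%N nu i = nth 0%N nu' i) ->
    (size nu <= size nu')%N.
  move=> eqn; rewrite leqNgt; apply/negP => lt_s.
  have /and3P[_ /negP nu0 _] := partsP nu; apply: nu0.
  by rewrite -(nth_default 0%N (leqnn (size nu'))) -eqn mem_nth.
apply: parts_inj; apply: (@eq_from_nth _ 0%N) => //.
by apply/eqP; rewrite eqn_leq !le_size // => i; rewrite eq_nth.
Qed.

(** The count is part [i] of the conjugate of [ss]: both sides say that the box in row [i] and
    column [j] belongs to the diagram with column lengths [ss]. *)
Lemma count_sorted (ss : seq nat) i j : sorted geq ss ->
  (j < count (ltn i) ss)%N = (i < nth 0%N ss j)%N.
Proof.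
have geq_trans : transitive geq by move=> x y z /= yx zx; apply: leq_trans yx.
elim: ss j => [|m ss IH] j; first by rewrite nth_nil.
rewrite /= (path_sortedE geq_trans) => /andP[/allP le_m /IH {}IH].
case: (ltnP i m) => [ltim|lemi]; first by case: j => [|j] //=; rewrite add1n ltnS IH.
have -> : count (ltn i) ss = 0%N.
  apply/eqP; rewrite -leqn0 leqNgt -has_count; apply/hasPn => k /le_m /= lekm.
  by rewrite -leqNgt (leq_trans lekm).
apply/esym/negbTE; rewrite -leqNgt; case: j => [|j] //=.
case: (ltnP j (size ss)) => [lt_j|/(nth_default 0%N) ->] //.
by apply: leq_trans lemi; apply/le_m/mem_nth.
Qed.

(** The class sizes in decreasing order are the column lengths of a diagram, and each column is
    filled with the corresponding class. The weight depends only on the class sizes. *)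
Lemma coloring_tableau n (c : 'I_n -> nat) : (forall x, c x <= n)%N ->
  exists (lam : intpart n) (t : tableau lam),
    (forall x y, (c x == c y) = (tab_col t x == tab_col t y)) /\
    weight c = weight (tab_col t).
Proof.
move=> c_le; pose sz j := #|color_class c j|.
pose js := sort (relpre sz geq) (iota 0 n.+1).
have js_perm : perm_eq js (iota 0 n.+1) by rewrite perm_sort.
have js_uniq : uniq js by rewrite sort_uniq iota_uniq.
have sz_js : size js = n.+1 by rewrite size_sort size_iota.
pose ss := map sz js.
have ss_sorted : sorted geq ss.
  by rewrite sorted_map; apply: sort_sorted => i j; apply: leq_total.
(* The conjugate of [ss], cut off at the length [head 0%N ss] of the longest column so that no part
   is zero. *)
pose lams := mkseq (fun i => count (ltn i) ss) (head 0%N ss).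
have nth_lams i : (i < head 0%N ss)%N -> nth 0%N lams i = count (ltn i) ss.
  by move=> lti; rewrite nth_mkseq.
have sum_sz : (\sum_(k <- ss) k)%N = n.
  rewrite big_map (perm_big _ js_perm) -[iota 0 n.+1]/(index_iota 0 n.+1) big_mkord.
  rewrite -[RHS]card_ord -sum1_card.
  rewrite (partition_big (fun x => Ordinal (c_le x : c x < n.+1)%N) xpredT) //=.
  apply: eq_bigr => j _; rewrite /sz -sum1_card.
  by apply: eq_bigl => x; rewrite inE -val_eqE.
have lamsP : is_partition n lams.
  apply/and3P; split.
  - apply/(sortedP 0%N) => i; rewrite size_mkseq => lti.
    rewrite !nth_lams ?(ltnW lti) // /=.
    by apply: sub_count => k /= /ltnW.
  - apply/mapP => [[i]]; rewrite mem_iota /= add0n => lti.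
    by apply/eqP; rewrite eq_sym -lt0n count_sorted // nth0.
  (* Double counting of the boxes, by rows and by columns. *)
  rewrite sumnE -[X in _ == X]sum_sz big_map; apply/eqP.
  under eq_bigr => i _ do rewrite -sum1_count big_mkcond.
  rewrite exchange_big /= !big_seq; apply: eq_bigr => k ss_k.
  have le_k : (k <= head 0%N ss)%N.
    have geq_trans : transitive geq by move=> x y z /= yx zx; apply: leq_trans yx.
    case: (ss) ss_sorted ss_k => //= m ss'.
    rewrite (path_sortedE geq_trans) inE => /andP[/allP le_m _].
    by case/orP=> [/eqP -> //|/le_m].
  rewrite -big_mkcond sum1_count -(subnKC le_k) iotaD count_cat add0n.
  have -> : count [pred i | (i < k)%N] (iota 0 k) = k.
    rewrite -[RHS](size_iota 0) -count_predT; apply: eq_in_count => i.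
    by rewrite mem_iota.
  rewrite (_ : count _ (iota k _) = 0%N) ?addn0 //.
  apply/eqP; rewrite -leqn0 leqNgt -has_count; apply/hasPn => i.
  by rewrite mem_iota -leqNgt => /andP[].
pose lam := IntPart lamsP.
have lt_size (b : box lam) : (box_col b < n.+1)%N.
  have := box_col_lt b; rewrite nth_lams; last first.
    by rewrite -[X in (_ < X)%N](size_mkseq (fun i => count (ltn i) ss)) /box_row ltn_ord.
  by move=> /leq_trans-> //; rewrite -sz_js -(size_map sz) count_size.
have row_lt (b : box lam) : (box_row b < sz (nth 0%N js (box_col b)))%N.
  have := box_col_lt b; rewrite nth_lams; last first.
    by rewrite -[X in (_ < X)%N](size_mkseq (fun i => count (ltn i) ss)) /box_row ltn_ord.
  by rewrite count_sorted // (nth_map 0%N) // sz_js.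
have [f fP] : exists f : box lam -> 'I_n, forall b,
    c (f b) = nth 0%N js (box_col b) /\
    index (f b) (enum (color_class c (nth 0%N js (box_col b)))) = box_row b.
  apply: (@fin_all_exists _ _ (fun b x => c x = nth 0%N js (box_col b) /\
    index x (enum (color_class c (nth 0%N js (box_col b)))) = box_row b)) => b.
  have := row_lt b; rewrite /sz cardE; set s := enum _ => lt_b.
  have [x0 _] : exists x0 : 'I_n, true by case: s lt_b => // x0; exists x0.
  exists (nth x0 s (box_row b)); split; last by rewrite index_uniq ?enum_uniq.
  have := mem_nth x0 lt_b; rewrite mem_enum inE.
  by move/eqP.
have f_inj : injectiveb [ffun b => f b].
  apply/injectiveP=> b b'; rewrite !ffunE => eqf.
  have [cb rb] := fP b; have [cb' rb'] := fP b'.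
  have eq_col : box_col b = box_col b'.
    by apply/eqP; rewrite -(nth_uniq 0%N _ _ js_uniq) ?sz_js ?lt_size // -cb -cb' eqf.
  by apply: box_inj => //; rewrite -rb -rb' eqf eq_col.
pose t : tableau lam :=
  exist (fun u : {ffun box lam -> 'I_n} => injectiveb u) _ f_inj.
have c_tab x : c x = nth 0%N js (tab_col t x) /\ (tab_col t x < n.+1)%N.
  have [b <-] := tableau_surj t x; rewrite tab_colE lt_size; split=> //.
  by rewrite ffunE (proj1 (fP b)).
exists lam, t; split=> [x y|].
  have [[-> ltx] [-> lty]] := (c_tab x, c_tab y).
  by rewrite nth_uniq ?sz_js.
rewrite /weight -!(big_mkord xpredT (fun j => (2 ^ #|color_class _ j|).-1)).
rewrite -(perm_big _ js_perm) /= (big_nth 0%N) sz_js !big_mkord.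
apply: eq_bigr => j _; congr (2 ^ _).-1.
congr #|pred_of_set _|; apply/setP=> x; rewrite !inE.
have [-> ltx] := c_tab x.
by rewrite nth_uniq ?sz_js.
Qed.

(** * Garnir relations and straightening *)

Section SignedSums.

Variables (n d : nat) (K : fieldType) (rG : mx_representation K [set: 'S_n] d).
Implicit Types (P A : {set 'S_n}) (g h s : 'S_n).

Definition signed_sum P : 'M[K]_d := \sum_(s in P) (-1) ^+ odd_perm s *: rG s.

Lemma signed_sum_lcoset P g :
  signed_sum (g *: P)%g = (-1) ^+ odd_perm g *: (rG g *m signed_sum P).
Proof.
rewrite /signed_sum (reindex_inj (mulgI g)) mulmx_sumr scaler_sumr.
apply: eq_big => [s|s _]; first by rewrite mem_lcoset mulKg.
by rewrite repr_mxM ?inE // odd_permM signr_addb -scalemxAr scalerA.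
Qed.

Lemma signed_sum_mull (H : {group 'S_n}) h : h \in H ->
  rG h *m signed_sum H = (-1) ^+ odd_perm h *: signed_sum H.
Proof.
move=> Hh; rewrite -[in RHS](lcoset_id Hh) signed_sum_lcoset.
by rewrite scalerA -signr_addb addbb scale1r.
Qed.

Lemma signed_sum_conj P s :
  signed_sum (P :^ s)%g = rG s^-1%g *m signed_sum P *m rG s.
Proof.
rewrite /signed_sum mulmx_sumr mulmx_suml (reindex_inj (conjg_inj s)) /=.
apply: eq_big => [u|u _]; first by rewrite memJ_conjg.
by rewrite odd_permJ -scalemxAr -scalemxAl -!repr_mxM ?inE // conjgE mulgA.
Qed.

(** The product set is a disjoint union of left cosets of [H], and each contributes the sum over [H]
    translated by its representative. *)
Lemma signed_sum_lcosets A (H : {group 'S_n}) :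
  signed_sum (A * H)%g = \sum_(X in lcosets H A)
    (-1) ^+ odd_perm (repr X) *: (rG (repr X) *m signed_sum H).
Proof.
rewrite {1}/signed_sum (partition_big (fun s => s *: H)%g (mem (lcosets H A))) /=.
  apply: eq_bigr => X /lcosetsP[x Ax defX].
  have defX' : (repr X *: H)%g = X.
    rewrite [RHS]defX; apply/lcoset_eqP.
    by rewrite -defX (mem_repr x) // defX lcoset_refl.
  rewrite -signed_sum_lcoset defX' /signed_sum; apply: eq_bigl => s.
  have -> : ((s *: H)%g == X) = (s \in X).
    by move: (repr X) defX' => y <-; apply/eqP/idP => /lcoset_eqP.
  apply: andb_idl; rewrite defX => /lcosetP[h Hh ->].
  by rewrite mem_mulg.
by move=> s; rewrite /= mem_lcosets.
Qed.

Hypothesis rGT : forall g, (rG g)^T = rG g^-1%g.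

(** The group acts by orthogonal matrices, as in permutation modules, so transposition corresponds
    to inversion and exchanges left and right relations. *)
Lemma trmx_signed_sum P : (signed_sum P)^T = signed_sum P^-1%g.
Proof.
rewrite /signed_sum linear_sum [RHS](reindex_inj (@invg_inj _)) /=.
apply: eq_big => [s|s _]; first by rewrite mem_invg invgK.
by rewrite linearZ /= rGT odd_permV.
Qed.

Lemma trmx_signed_sum_group (H : {group 'S_n}) : (signed_sum H)^T = signed_sum H.
Proof. by rewrite trmx_signed_sum invGid. Qed.

Lemma signed_sum_mulr (H : {group 'S_n}) h : h \in H ->
  signed_sum H *m rG h = (-1) ^+ odd_perm h *: signed_sum H.
Proof.
move=> Hh; apply: trmx_inj; rewrite trmx_mul rGT linearZ /= trmx_signed_sum_group.
by rewrite signed_sum_mull ?groupV // odd_permV.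
Qed.

End SignedSums.

Section Garnir.

Variables (n : nat) (r c : 'I_n -> nat) (x0 y0 : 'I_n).
Hypothesis c_lt : forall x, (c x < n)%N.

Local Notation H := (color_stab_group c).
Local Notation G := (Sym_group (garnir_set r c x0 y0)).
Local Notation Q := (color_stab_group (garnir_coloring r c x0 y0)).

(* An element of [Q] is the product of an element of [H] and of its restriction
   to the Garnir set, and it normalises [G]. *)
Lemma garnir_mulG : (H * G * Q)%g = (H * G)%g.
Proof.
set X := garnir_set r c x0 y0.
have memX q z : q \in Q -> (q z \in X) = (z \in X).
  move/color_stabP/(_ z); rewrite /garnir_coloring -/X.
  have ne_c x : (c x == n) = false by rewrite ltn_eqF.
  case: (z \in X); case: (q z \in X) => // /eqP; rewrite ?ne_c //.
  by rewrite eq_sym ne_c.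
have QHG q : q \in Q -> q \in (H * G)%g.
  move=> Qq; rewrite -(mulgKV (restr_perm X q) q).
  apply: mem_mulg; last by rewrite inE restr_perm_on.
  have Nq : q \in 'N(X | 'P).
    by rewrite !inE; apply/subsetP=> z Xz; rewrite inE /= apermE memX.
  apply/color_stabP=> z; rewrite permM; case: (boolP (z \in X)) => [Xz|Xz].
    by rewrite -(restr_permE Nq Xz) permK.
  have Xqz : q z \notin X by rewrite memX.
  rewrite (out_perm (perm_onV (restr_perm_on X q))) //.
  by move/color_stabP/(_ z): Qq; rewrite /garnir_coloring -/X (negPf Xz) (negPf Xqz).
have QJG q g : q \in Q -> g \in G -> (g ^ q)%g \in G.
  move=> Qq; rewrite !inE => Gg; apply/subsetP=> z; rewrite inE; apply: contraR => Xz.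
  rewrite conjgE !permM (out_perm Gg) ?permKV //.
  by rewrite -(memX _ _ Qq) permKV.
apply/eqP; rewrite eqEsubset; apply/andP; split; last first.
  by apply/subsetP=> z HGz; rewrite -[z]mulg1 mem_mulg.
apply/subsetP=> _ /mulsgP[_ q /mulsgP[h g Hh Gg ->] Qq ->].
have /mulsgP[h' g' Hh' Gg' def_q] := QHG q Qq.
have -> : (h * g * q = h * h' * (g' * g ^ q))%g.
  by rewrite !mulgA -(mulgA h h') -def_q -!mulgA mulKVg.
by apply: mem_mulg; rewrite groupM ?QJG //.
Qed.

Variables (d : nat) (K : fieldType) (rG : mx_representation K [set: 'S_n] d).
Hypothesis rGT : forall g, (rG g)^T = rG g^-1%g.

(* Both sides are the signed sum over [G * H], split along cosets of [H] and of
   [Q]. *)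
Lemma garnir_relation_left :
  \sum_(X in lcosets H G)
     (-1) ^+ odd_perm (repr X) *: (rG (repr X) *m signed_sum rG H)
  = \sum_(Y in lcosets Q (H * G)%g)
      (-1) ^+ odd_perm (repr Y) *: (signed_sum rG Q *m rG (repr Y)^-1%g).
Proof.
rewrite -signed_sum_lcosets; apply: trmx_inj.
rewrite trmx_signed_sum // invMg !invGid -garnir_mulG signed_sum_lcosets.
rewrite linear_sum garnir_mulG.
apply: eq_bigr => Y _; rewrite linearZ /= trmx_mul rGT invgK.
by rewrite trmx_signed_sum_group.
Qed.

(** The transpose of [garnir_relation_left]. The left relation serves to rewrite contents, this one
    to rewrite places. *)
Lemma garnir_relation_right :
  \sum_(X in lcosets H G)
     (-1) ^+ odd_perm (repr X) *: (signed_sum rG H *m rG (repr X)^-1%g)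
  = \sum_(Y in lcosets Q (H * G)%g)
      (-1) ^+ odd_perm (repr Y) *: (rG (repr Y) *m signed_sum rG Q).
Proof.
apply: trmx_inj; rewrite !linear_sum.
transitivity (\sum_(X in lcosets H G)
    (-1) ^+ odd_perm (repr X) *: (rG (repr X) *m signed_sum rG H)).
  apply: eq_bigr => X _; rewrite linearZ /= trmx_mul rGT invgK.
  by rewrite trmx_signed_sum_group.
rewrite garnir_relation_left; apply: eq_bigr => Y _; rewrite linearZ /= trmx_mul rGT.
by rewrite trmx_signed_sum_group.
Qed.

End Garnir.

(** * Straightening, in a form common to contents and places *)

Section Straightening.

Variables (n d : nat) (K : fieldType) (r c : 'I_n -> nat).
Hypothesis rc : diagram r c.
Hypothesis K2 : (2%:R : K) != 0.

Variables (E : finType) (act : E -> 'S_n -> E) (F : E -> 'I_n -> nat).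
Hypothesis F_act : forall e s x, F (act e s) x = F e (s^-1%g x).
Hypothesis F_inj : forall e e', F e =1 F e' -> e = e'.

Variables (Phi : E -> 'rV[K]_d) (W : 'M[K]_d).
Hypothesis Phi_col : forall e h, h \in color_stab c ->
  Phi (act e h) = (-1) ^+ odd_perm h *: Phi e.
Hypothesis Phi_garnir : forall e x0 y0, r x0 = r y0 -> (c x0 < c y0)%N ->
  ((\sum_(X in lcosets (color_stab c) (Sym (garnir_set r c x0 y0)))
     (-1) ^+ odd_perm (repr X) *: Phi (act e (repr X)))%R <= W)%MS.

(** The transposition of [x] and [y] fixes [e] but negates [Phi e], and 2 is invertible. *)
Lemma alternating_eq0 e x y : x != y -> c x = c y -> F e x = F e y -> Phi e = 0.
Proof.
move=> nexy cxy Fxy; have ch : tperm x y \in color_stab c.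
  by apply/color_stabP=> z; case: tpermP => [->|->|].
have /F_inj eh : F (act e (tperm x y)) =1 F e.
  by move=> z; rewrite F_act tpermV; case: tpermP => [->|->|].
have := Phi_col e ch; rewrite eh odd_tperm nexy expr1 scaleN1r => /eqP.
rewrite -addr_eq0 -mulr2n -scaler_nat scaler_eq0.
by rewrite (negPf K2) => /eqP.
Qed.

Hypothesis Phi_standard : forall e, strictly_increasing c r (F e) ->
  weakly_increasing r c (F e) -> (Phi e <= W)%MS.

(** Induction towards larger column scores, which are bounded as [E] is finite. A repeated entry in
    a column gives 0; otherwise the columns are sorted at the cost of a sign. A descent in a row is
    then removed by a Garnir relation whose other terms have larger scores. *)
Lemma straightening e : (Phi e <= W)%MS.
Proof.
pose bound := (\max_(e : E) score c (F e)).+1.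
have [m] := ubnP (bound - score c (F e)); elim: m e => // m IH e lt_m.
have [/existsP[x /existsP[y /and3P[nexy /eqP cxy /eqP Fxy]]]|col_inj] :=
    boolP [exists x, exists y, [&& x != y, c x == c y & F e x == F e y]].
  by rewrite (alternating_eq0 nexy cxy Fxy) sub0mx.
have [h ch incFh] := exists_sorted r c (F e).
pose e1 := act e h^-1%g.
have Fe1 : F e1 =1 F e \o h by move=> x; rewrite F_act invgK.
have chV : h^-1%g \in color_stab c by rewrite groupV.
suff: (Phi e1 <= W)%MS.
  by rewrite Phi_col // eqmx_scale // signr_eq0.
have score_e1 : score c (F e1) = score c (F e).
  rewrite /score [RHS](reindex_inj (@perm_inj _ h)); apply: eq_bigr => x _.
  by rewrite Fe1 /= (color_stabP _ _ ch).
have strict1 : strictly_increasing c r (F e1).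
  move=> x y cxy rxy; rewrite ltn_neqAle !Fe1 incFh // andbT.
  apply: contra col_inj => /eqP /= Fxy; apply/existsP; exists (h x).
  apply/existsP; exists (h y); rewrite !(color_stabP _ _ ch) cxy Fxy !eqxx !andbT.
  by rewrite (inj_eq perm_inj); apply: contraTneq rxy => ->; rewrite ltnn.
have [/existsP[x0 /existsP[y0 /and3P[/eqP rxy cxy Fxy]]]|row_inc] :=
    boolP [exists x, exists y, [&& r x == r y, (c x < c y)%N & (F e1 y < F e1 x)%N]];
  last first.
  apply: Phi_standard strict1 _ => x y rxy cxy; rewrite leqNgt.
  apply: contra row_inc => Fxy; apply/existsP; exists x; apply/existsP; exists y.
  by rewrite rxy eqxx cxy.
have := Phi_garnir e1 rxy cxy.
(* The coset of the identity contributes [Phi e1], which the relation expresses modulo [W] through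
   the other cosets. *)
set G := Sym _; have H_coset : (color_stab c : {set 'S_n}) \in lcosets (color_stab c) G.
  by apply/lcosetsP; exists 1%g; rewrite ?mul1g // inE perm_on1.
rewrite (bigD1 _ H_coset) /= (repr_group (color_stab_group c)) odd_perm1 expr0 scale1r.
rewrite Phi_col ?group1 // odd_perm1 expr0 scale1r => sumW.
rewrite -[Phi e1](addrK (\sum_(X in lcosets (color_stab c) G | X != color_stab c)
     (-1) ^+ odd_perm (repr X) *: Phi (act e1 (repr X)))).
apply: addmx_sub sumW _; rewrite eqmx_opp; apply: summx_sub => X /andP[].
move=> /lcosetsP[g Gg ->] neH; apply: scalemx_sub; apply: IH.
(* The factor [h'] in the chosen representative preserves columns, so it does not affect the
   score. *)
have /lcosetP[h' ch' ->] := mem_repr g (lcoset_refl (color_stab_group c) g).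
have ncg : g \notin color_stab c.
  by apply: contra neH => cg; rewrite (lcoset_id (cg : g \in color_stab_group c)).
have lt_score : (score c (F e1) < score c (F (act e1 (g * h')%g)))%N.
  have -> : score c (F (act e1 (g * h')%g)) = score (c \o g) (F e1).
    rewrite /score (reindex_inj (@perm_inj _ (g * h')%g)); apply: eq_bigr => x _.
    by rewrite F_act permK /= permM (color_stabP _ _ ch').
  by apply: (garnir_score rxy cxy Fxy) => //; [apply: (proj1 rc) | rewrite inE in Gg].
have : (score c (F (act e1 (g * h')%g)) < bound)%N.
  by rewrite ltnS; apply: (@leq_bigmax _ (fun e => score c (F e))).
move: lt_score lt_m; rewrite score_e1; clearbody bound; clear.
move: (score _ _) (score _ _) => p q; lia.
Qed.

End Straightening.

(** The fillings are now the permutations [s], with [s x] in the box [x]; multiplying by [g^-1] on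
    the left moves the boxes. *)
Lemma straightening_place (n d : nat) (K : fieldType) (r c : 'I_n -> nat)
    (rG : mx_representation K [set: 'S_n] d) (u : 'rV[K]_d) (W : 'M[K]_d) :
  diagram r c -> (2%:R : K) != 0 ->
  (forall g, (rG g)^T = rG g^-1%g) -> (forall x, (c x < n)%N) ->
  (forall x0 y0 g s, r x0 = r y0 -> (c x0 < c y0)%N ->
     (u *m rG g *m signed_sum rG (color_stab (garnir_coloring r c x0 y0)) *m rG s
      <= W)%MS) ->
  (forall s : 'S_n, strictly_increasing c r (fun x => s x) ->
     weakly_increasing r c (fun x => s x) ->
     (u *m signed_sum rG (color_stab c) *m rG s <= W)%MS) ->
  forall s, (u *m signed_sum rG (color_stab c) *m rG s <= W)%MS.
Proof.
move=> rc K2 rGT c_lt W_heavier stdW.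
apply: (straightening (act := fun s g => (g^-1 * s)%g)
  (F := fun s x => val (s x)) rc K2).
- by move=> s g x; rewrite permM.
- by move=> s s' eqs; apply/permP => x; apply: val_inj; apply: eqs.
- move=> s h ch; rewrite repr_mxM ?inE // mulmxA -(mulmxA u).
  have chV : h^-1%g \in color_stab_group c by rewrite groupV.
  by rewrite (signed_sum_mulr rGT chV) odd_permV -scalemxAr -scalemxAl.
- move=> s x0 y0 rxy cxy; set X := Sym _.
  have -> : \sum_(Y in lcosets (color_stab c) X) (-1) ^+ odd_perm (repr Y) *:
        (u *m signed_sum rG (color_stab c) *m rG ((repr Y)^-1 * s)%g)
      = u *m (\sum_(Y in lcosets (color_stab c) X) (-1) ^+ odd_perm (repr Y) *:
          (signed_sum rG (color_stab c) *m rG (repr Y)^-1%g)) *m rG s.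
    rewrite [X in _ = X *m _]mulmx_sumr mulmx_suml; apply: eq_bigr => Y _.
    by rewrite repr_mxM ?inE // -scalemxAr -scalemxAl !mulmxA.
  rewrite (garnir_relation_right r x0 y0 c_lt rGT).
  rewrite mulmx_sumr mulmx_suml; apply: summx_sub => Y _.
  by rewrite -scalemxAr -scalemxAl scalemx_sub // mulmxA W_heavier.
exact: stdW.
Qed.

(** * Finiteness of the set of partitions *)

Lemma size_partition n (lam : intpart n) : (size lam <= n)%N.
Proof.
have /and3P[_ + /eqP defn] := partsP lam; rewrite -[X in (_ <= X)%N]defn.
by elim: (parts lam) => //= m s IH; rewrite inE negb_or => /andP[+ /IH]; lia.
Qed.

Lemma part_bound n (lam : intpart n) i : (nth 0%N lam i < n.+1)%N.
Proof.
by rewrite ltnS -(card_tab_row (std_tableau lam)) -[X in (_ <= X)%N](card_ord n) max_card.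
Qed.

(** A partition padded with zeros to length [n]. This makes [intpart n] a finite type, so that sums
    of submodules can run over shapes. *)
Definition part_code n (lam : intpart n) : {ffun 'I_n -> 'I_n.+1} :=
  [ffun i : 'I_n => Ordinal (part_bound lam i)].

Definition part_decode n (f : {ffun 'I_n -> 'I_n.+1}) : option (intpart n) :=
  if insub [seq k <- [seq val (f i) | i <- enum 'I_n] | k != 0%N] is
    Some (exist s sP) then Some (@IntPart n s sP) else None.

Lemma part_codeK n : pcancel (@part_code n) (@part_decode n).
Proof.
move=> lam; rewrite /part_decode.
have -> : [seq k <- [seq val (part_code lam i) | i <- enum 'I_n] | k != 0%N] = lam.
  have -> : [seq val (part_code lam i) | i <- enum 'I_n] = map (nth 0%N lam) (iota 0 n).
    by rewrite -val_enum_ord -map_comp; apply: eq_map => i; rewrite /= ffunE.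
  rewrite -[X in iota 0 X](subnKC (size_partition lam)) iotaD map_cat filter_cat add0n.
  rewrite [X in _ ++ X](_ : _ = [::]); last first.
    apply/eqP; rewrite -size_eq0 size_filter -leqn0 leqNgt -has_count; apply/hasPn => k.
    by move=> /mapP[i]; rewrite mem_iota => /andP[/(nth_default 0%N)-> _] ->.
  have /and3P[_ lam0 _] := partsP lam.
  rewrite cats0 -/(mkseq _ _) mkseq_nth; apply/all_filterP/allP => k lam_k /=.
  by apply: contraNneq lam0 => <-.
by rewrite (insubT (is_partition n) (partsP lam)) /=; congr Some; apply: parts_inj.
Qed.

HB.instance Definition _ n := Finite.copy (intpart n) (pcan_type (@part_codeK n)).

Lemma sum_unique (V : zmodType) (I : finType) (P : pred I) (F : I -> V) i0 :
  P i0 -> (forall i, P i -> F i != 0 -> i = i0) -> \sum_(i | P i) F i = F i0.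
Proof.
move=> Pi0 F0; rewrite (bigD1 i0) //= big1 ?addr0 // => i /andP[Pi ne_i].
by apply/eqP; apply: contraNT ne_i => /(F0 i Pi) ->.
Qed.

(** * Kernels and images of equivariant maps *)

Section FreeLifts.

Variables (K : fieldType) (I : finType) (P : pred I) (n : nat) (b : I -> 'rV[K]_n).

Definition span_mx : 'M[K]_(#|I|, n) :=
  \matrix_(k < #|I|) (if P (enum_val k) then b (enum_val k) else 0).

Lemma sub_span_mx i : P i -> (b i <= span_mx)%MS.
Proof. by move=> Pi; apply: (eq_row_sub (enum_rank i)); rewrite rowK enum_rankK Pi. Qed.

Lemma mul_span_mx (a : 'rV_#|I|) :
  a *m span_mx = \sum_(i | P i) a 0 (enum_rank i) *: b i.
Proof.
rewrite mulmx_sum_row (reindex_onto enum_rank enum_val) => [|k _]; last exact: enum_valK.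
rewrite [RHS]big_mkcond; apply: eq_big => i; first by rewrite enum_rankK eqxx.
by rewrite rowK enum_rankK; case: ifP => // _; rewrite scaler0.
Qed.

(** Modulo [V] an element of [U] is a combination of the [b i]; if [C] kills it, independence of the
    images makes the coefficients vanish. *)
Lemma kernel_of_free_lifts m (V U : 'M[K]_n) (C : 'M_(n, m)) :
  V *m C = 0 -> (U <= V + span_mx)%MS ->
  (forall a : I -> K, \sum_(i | P i) a i *: (b i *m C) = 0 -> forall i, P i -> a i = 0) ->
  forall x : 'rV_n, (x <= U)%MS -> x *m C = 0 -> (x <= V)%MS.
Proof.
move=> VC0 UB freeC x /submx_trans/(_ UB)/sub_addsmxP[[u a] /= ->].
rewrite mulmxDl -mulmxA VC0 mulmx0 add0r mul_span_mx mulmx_suml => sum0.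
rewrite big1 ?addr0 ?submxMl // => i Pi.
rewrite (freeC (fun i => a 0 (enum_rank i)) _ i Pi) ?scale0r //.
by rewrite -[RHS]sum0; apply: eq_bigr => j _; rewrite scalemxAl.
Qed.

End FreeLifts.

Section Generalities.

Variables (K : fieldType) (gT : finGroupType) (G : {group gT}).

Lemma trmx_perm_module (aT : finGroupType) (T : finType) (to : {action aT &-> T}) g :
  (perm_module to K g)^T = perm_module to K g^-1%g.
Proof.
apply/matrixP=> i j; rewrite !mxE; congr (_ %:R).
by rewrite eq_sym (can2_eq (actK to g) (actKV to g)).
Qed.

Lemma cyclic_mx_subP n (rG : mx_representation K G n) (u : 'rV_n) m (W : 'M_(m, n)) :
  (forall g, g \in G -> (u *m rG g <= W)%MS) -> (cyclic_mx rG u <= W)%MS.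
Proof.
move=> uW; apply/rV_subP => v /cyclic_mxP[A /envelop_mxP[a ->] ->].
rewrite mulmx_sumr summx_sub // => g Gg.
by rewrite -scalemxAr scalemx_sub ?uW.
Qed.

Lemma cyclic_mx_hom n m (rG : mx_representation K G n) (rG' : mx_representation K G m)
    (u : 'rV_n) (C : 'M_(n, m)) :
  (forall g, g \in G -> rG g *m C = C *m rG' g) ->
  (cyclic_mx rG u *m C :=: cyclic_mx rG' (u *m C))%MS.
Proof.
move=> CJ; apply/eqmxP/andP; split; last first.
  apply: cyclic_mx_subP => g Gg; rewrite -mulmxA -CJ // mulmxA submxMr //.
  by rewrite mxmodule_trans ?cyclic_mx_module ?cyclic_mx_id.
apply/rV_subP => _ /submxP[y ->]; rewrite mulmxA.
have /cyclic_mxP[A /envelop_mxP[a ->] ->] := submxMl y (cyclic_mx rG u).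
rewrite mulmx_sumr mulmx_suml summx_sub // => g Gg.
rewrite -scalemxAr -scalemxAl scalemx_sub // -mulmxA CJ // mulmxA.
by rewrite mxmodule_trans ?cyclic_mx_module ?cyclic_mx_id.
Qed.

(** The isomorphism theorem for [C] on [U]; the lift [B] chooses preimages by a pseudo-inverse. *)
Lemma section_of_hom n m (rG : mx_representation K G n) (rG' : mx_representation K G m)
    (V U : 'M_n) (C : 'M_(n, m)) (S : 'M_m) (modS : mxmodule rG' S) :
  (forall g, g \in G -> rG g *m C = C *m rG' g) ->
  (U *m C :=: S)%MS -> V *m C = 0 ->
  (forall x : 'rV_n, (x <= U)%MS -> x *m C = 0 -> (x <= V)%MS) ->
  is_section rG (submod_repr modS) V U.
Proof.
move=> CJ US VC0 kerC; pose D := in_submod S (U *m C).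
have UCS : (U *m C <= S)%MS by rewrite US.
have fullD : row_full D.
  by rewrite -sub1mx -val_submodS val_submod1 in_submodK // US.
pose B := pinvmx D *m U; exists (in_submod S C), B.
have mulC k (x : 'M_(k, n)) : x *m in_submod S C = in_submod S (x *m C).
  by rewrite in_submodE mulmxA -in_submodE.
have BC : B *m in_submod S C = 1%:M.
  by rewrite mulC -mulmxA in_submodE -mulmxA -in_submodE -/D mulVpmx.
split.
- by rewrite mulC VC0 linear0.
- exact: BC.
- exact: submxMl.
- rewrite -[X in (X <= _)%MS](subrK (D *m B)) addmx_sub_adds ?submxMl //.
  apply/rV_subP=> x /submxP[y ->].
  apply: kerC.
    by rewrite mulmx_sub // addmx_sub // eqmx_opp mulmxA submxMl.
  rewrite -mulmxA mulmxBl -(mulmxA D).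
  have -> : U *m C = val_submod D by rewrite in_submodK.
  have -> : B *m C = val_submod (1%:M : 'M_(\rank S)).
    by rewrite -BC mulC in_submodK // -mulmxA mulmx_sub.
  by rewrite -val_submodE subrr mulmx0.
move=> g Gg; rewrite !mulC -mulmxA CJ // mulmxA in_submodJ //.
Qed.

End Generalities.

(** * Chains from an ordered family of submodules *)

Section ChainOfOrder.

Variables (K : fieldType) (gT : finGroupType) (G : {group gT}).
Variable P : forall d, mx_representation K G d -> Prop.
Variables (n : nat) (rG : mx_representation K G n).

Lemma sub_sums_seq (I : eqType) (F : I -> 'M[K]_n) (s : seq I) i :
  i \in s -> (F i <= \sum_(j <- s) F j)%MS.
Proof.
elim: s => // j s IH; rewrite inE big_cons => /orP[/eqP ->|/IH le_s].
  exact: addsmxSl.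
exact: submx_trans le_s (addsmxSr _ _).
Qed.

Lemma sums_seq_sub (I : eqType) (F : I -> 'M[K]_n) (s : seq I) (W : 'M_n) :
  (forall i, i \in s -> (F i <= W)%MS) -> (\sum_(i <- s) F i <= W)%MS.
Proof.
move=> FW; rewrite big_seq; apply: (big_ind (fun A : 'M_n => (A <= W)%MS)) => //.
  exact: sub0mx.
by move=> A B; rewrite addsmx_sub => -> ->.
Qed.

(* [V] stands for the sum of the [X j] with [j] strictly before [i]; ties in
   the preorder [before] may be broken in any way. *)
Lemma chain_of_order (I : finType) (std : pred I) (before : rel I) (X : I -> 'M[K]_n) :
  total before -> transitive before ->
  (forall i, std i -> mxmodule rG (X i)) ->
  (forall i (V : 'M_n), std i -> mxmodule rG V ->
     (forall j, std j -> ~~ before i j -> (X j <= V)%MS) ->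
     (forall W : 'M_n, (forall j, std j -> before j i -> j != i -> (X j <= W)%MS) ->
        (V <= W)%MS) ->
     exists d (r : mx_representation K G d), P r /\ is_section rG r V (V + X i)%MS) ->
  chain P rG 0 (\sum_(i | std i) X i)%MS.
Proof.
move=> bef_total bef_trans modX step.
pose items := sort before [seq i <- enum I | std i].
have mem_items i : (i \in items) = std i.
  by rewrite mem_sort mem_filter mem_enum andbT.
have items_uniq : uniq items by rewrite sort_uniq filter_uniq ?enum_uniq.
have items_before : pairwise before items.
  by rewrite -(sorted_pairwise bef_trans) sort_sorted.
suff ch s s' : items = s ++ s' -> chain P rG 0 (\sum_(i <- s) X i)%MS.
  apply: chain_eqmx (ch items [::] _) _; first by rewrite cats0.
  apply/eqmxP/andP; split.
    by apply: sums_seq_sub => i; rewrite mem_items => std_i; apply: (sumsmx_sup i).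
  by apply/sumsmx_subP => i std_i; apply: sub_sums_seq; rewrite mem_items.
elim/last_ind: s s' => [|s i IH] s' def_items.
  by rewrite big_nil; apply: chain_refl => //; apply: mxmodule0.
rewrite cat_rcons in def_items; have {}IH := IH _ def_items.
have modV := chain_module IH.
have std_i : std i by rewrite -mem_items def_items mem_cat inE eqxx orbT.
move: items_before items_uniq; rewrite def_items pairwise_cat cat_uniq /=.
case/and3P=> /allrelP bef _ /andP[/allP bef_i _] /and3P[_ /norP[i_notin _] _].
set V := (\sum_(j <- s) X j)%MS in IH modV *.
have [|W V_le|d [r [Pr sec]]] := step i V std_i modV.
- move=> j std_j nbef; apply: sub_sums_seq; move: std_j.
  rewrite -mem_items def_items mem_cat inE => /or3P[//|/eqP def_j|/bef_i].
    by move: nbef; rewrite def_j; have := bef_total i i; rewrite orbb => ->.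
  by rewrite (negPf nbef).
- apply: sums_seq_sub => j s_j; apply: V_le.
  + by rewrite -mem_items def_items mem_cat s_j.
  + by rewrite bef // inE eqxx.
  + by apply: contraNneq i_notin => <-.
rewrite -cats1 big_cat big_seq1 /=; apply: (chain_step IH _ _ Pr sec).
  by rewrite addsmx_module ?modX.
exact: addsmxSl.
Qed.

End ChainOfOrder.

(** * Bideterminants and the Specht filtration *)

Section Bideterminants.

Variables (n : nat) (K : fieldType) (mu : intpart n).
Hypothesis K2 : (2%:R : K) != 0.
Implicit Types (c : 'I_n -> nat) (A B : tabloid mu) (s h : 'S_n).

Local Notation M := (Mrep mu K).
Local Notation vec := (tabloid_vec K).

Lemma trmx_Mrep s : (M s)^T = M s^-1%g.
Proof. exact: trmx_perm_module. Qed.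

(* In the polynomial ring on the letters [x_ij] with [i < n], where the tabloid
   [A] is the monomial with factors [x_(i, tabloid_row A i)], this is the
   product over the colour classes of [c] of the minors of [x] with rows in the
   class and columns listed by [A]. *)
Definition bidet c A : 'rV[K]_#|tabloid mu| := vec A *m signed_sum M (color_stab c).

Lemma bidet_act c A h : h \in color_stab c ->
  bidet c (tabloid_act mu A h) = (-1) ^+ odd_perm h *: bidet c A.
Proof.
move=> ch; rewrite /bidet -tabloid_vec_act -mulmxA.
by rewrite (signed_sum_mull _ (H := color_stab_group c)) // -scalemxAr.
Qed.

Lemma bidet_eq0 c A x y : x != y -> c x = c y -> tabloid_row A x = tabloid_row A y ->
  bidet c A = 0.
Proof.
move=> nexy cxy Axy.
apply: (alternating_eq0 K2 (@tabloid_row_act n mu) (@tabloid_row_inj n mu)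
  _ nexy cxy Axy).
by move=> e h; apply: bidet_act.
Qed.

(** By [bidet_eq0] the entries within a colour class are distinct, so sorting them makes them
    strictly increasing. *)
Lemma bidet_sorted c r A : jointly_injective r c -> bidet c A != 0 ->
  exists2 h, h \in color_stab c
    & strictly_increasing c r (tabloid_row (tabloid_act mu A h)).
Proof.
move=> inj_rc nz; have [h ch inc] := exists_sorted r c (tabloid_row A).
exists h^-1%g; first by rewrite (groupV (color_stab_group c)).
move=> x y cxy rxy; rewrite !tabloid_row_act invgK ltn_neqAle inc // andbT.
apply: contra nz => /eqP Axy; apply/eqP; apply: (@bidet_eq0 _ _ (h x) (h y)) => //.
  by rewrite (inj_eq perm_inj); apply: contraTneq rxy => ->; rewrite ltnn.
by rewrite !(color_stabP _ _ ch).
Qed.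

End Bideterminants.

(** * Semistandard fillings and straightening of bideterminants *)

Section Standard.

Variables (n : nat) (lam : intpart n).

Definition std_row := tab_row (std_tableau lam).
Definition std_col := tab_col (std_tableau lam).

(** The entries of [std_tableau] serve as names of the boxes, so that a filling is a function on
    ['I_n]. *)
Definition semistandard (F : 'I_n -> nat) : bool :=
  [forall x, forall y,
    ((std_col x == std_col y) && (std_row x < std_row y) ==> (F x < F y))%N &&
    ((std_row x == std_row y) && (std_col x < std_col y) ==> (F x <= F y))%N].

Lemma semistandardP F : reflect (strictly_increasing std_col std_row F /\
  weakly_increasing std_row std_col F) (semistandard F).
Proof.
apply: (iffP idP) => [/forallP sF|[sF wF]].
  split=> x y; have /forallP/(_ y)/andP[/implyP sc /implyP sr] := sF x.
    by move=> /eqP cxy rxy; apply: sc; rewrite cxy.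
  by move=> /eqP rxy cxy; apply: sr; rewrite rxy.
apply/forallP=> x; apply/forallP=> y; apply/andP.
by split; apply/implyP=> /andP[/eqP exy lxy]; [apply: sF | apply: wF].
Qed.

Lemma std_diagram : diagram std_row std_col. Proof. exact: tab_diagram. Qed.

Definition std_tabloid : tabloid lam := tabloid_of (std_tableau lam).

Lemma std_tabloid_row : tabloid_row std_tabloid =1 std_row.
Proof. exact: tabloid_rowE. Qed.

Lemma col_stab_std : col_stab (std_tableau lam) = color_stab std_col.
Proof. exact: col_stabE. Qed.

(** The row permutation [k] preserves the row score of [F], so [F' \o h] scores at least as much as
    [F'], and [strict_score] forces [h] to be trivial. Then [F] and [F'] differ by a row
    permutation, and both are sorted along rows. *)
Lemma semistandard_unique F F' h k :
  semistandard F -> semistandard F' ->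
  h \in color_stab std_col -> k \in color_stab std_row ->
  (forall x, F' (h x) = F (k x)) -> (score std_row F' <= score std_row F)%N ->
  h = 1%g /\ F =1 F'.
Proof.
move=> /semistandardP[sF wF] /semistandardP[sF' wF'] ch rk eqFF' le_score.
have [inj_rc _] := std_diagram.
have eq_score : score std_row (F' \o h) = score std_row F.
  rewrite /score [RHS](reindex_inj (@perm_inj _ k)); apply: eq_bigr => x _.
  by rewrite /= eqFF' (color_stabP _ _ rk).
have [le_h eq_h] := strict_score inj_rc sF' ch.
have h1 : h = 1%g by apply: eq_h; apply/eqP; rewrite eqn_leq le_h eq_score le_score.
split=> // x; have eqF : F \o k =1 F' by move=> y; rewrite /= -eqFF' h1 perm1.
rewrite -eqF; apply/esym; apply: (sorted_unique inj_rc rk wF) => y z ryz cyz.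
by rewrite !eqF; apply: wF'.
Qed.

End Standard.

Section Straighten.

Variables (n : nat) (K : fieldType) (mu lam : intpart n).
Hypothesis K2 : (2%:R : K) != 0.

Local Notation M := (Mrep mu K).
Local Notation vec := (tabloid_vec K).
Local Notation r := (std_row lam).
Local Notation c := (std_col lam).
Local Notation N := #|tabloid mu|.

Variables (W : 'M[K]_N).
Hypothesis W_heavier : forall c' A s, (forall x, (c' x <= n)%N) ->
  (weight c < weight c')%N -> (bidet K c' A *m M s <= W)%MS.

Lemma std_col_lt x : (c x < n)%N.
Proof. exact: diagram_col_lt (std_diagram lam) x. Qed.

Lemma garnir_coloring_le x0 y0 x : (garnir_coloring r c x0 y0 x <= n)%N.
Proof. by rewrite /garnir_coloring; case: ifP => // _; apply/ltnW/std_col_lt. Qed.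

(** Merging the Garnir set yields a heavier colouring, so the other side of each Garnir relation
    lies in [W]. *)
Lemma straighten_content :
  (forall A, semistandard lam (tabloid_row A) -> (bidet K c A <= W)%MS) ->
  forall A, (bidet K c A <= W)%MS.
Proof.
move=> stdW; apply: (straightening (std_diagram lam) K2 (@tabloid_row_act n mu)
  (@tabloid_row_inj n mu)).
- by move=> A h ch; apply: bidet_act.
- move=> A x0 y0 rxy cxy; set X := Sym _.
  have -> : \sum_(Y in lcosets (color_stab c) X)
        (-1) ^+ odd_perm (repr Y) *: bidet K c (tabloid_act mu A (repr Y))
      = vec A *m (\sum_(Y in lcosets (color_stab c) X)
        (-1) ^+ odd_perm (repr Y) *: (M (repr Y) *m signed_sum M (color_stab c))).
    rewrite mulmx_sumr; apply: eq_bigr => Y _.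
    by rewrite /bidet -tabloid_vec_act -scalemxAr mulmxA.
  rewrite (garnir_relation_left r x0 y0 std_col_lt (@trmx_Mrep n K mu)) mulmx_sumr.
  apply: summx_sub => Y _; rewrite -scalemxAr scalemx_sub // mulmxA.
  apply: W_heavier; first exact: garnir_coloring_le.
  exact: garnir_weight (std_diagram lam) _ _ rxy cxy.
by move=> A sA wA; apply/stdW/semistandardP.
Qed.

Lemma straighten_place A :
  (forall s : 'S_n, semistandard lam (fun x => s x) -> (bidet K c A *m M s <= W)%MS) ->
  forall s, (bidet K c A *m M s <= W)%MS.
Proof.
move=> stdW; apply: (straightening_place (std_diagram lam) K2 (@trmx_Mrep n K mu)).
- exact: std_col_lt.
- move=> x0 y0 g s rxy cxy; rewrite tabloid_vec_act.
  apply: W_heavier; first exact: garnir_coloring_le.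
  exact: garnir_weight (std_diagram lam) _ _ rxy cxy.
by move=> s sF wF; apply/stdW/semistandardP.
Qed.

End Straighten.

(** * Spanning by bideterminants of semistandard content *)

Section Spanning.

Variables (n : nat) (K : fieldType) (mu : intpart n).
Hypothesis K2 : (2%:R : K) != 0.

Local Notation M := (Mrep mu K).
Local Notation N := #|tabloid mu|.

Definition std_index (i : intpart n * tabloid mu) : bool :=
  semistandard i.1 (tabloid_row i.2).

Definition bidet_module (i : intpart n * tabloid mu) : 'M[K]_N :=
  cyclic_mx M (bidet K (std_col i.1) i.2).

Definition heavy_module (w : nat) : 'M[K]_N :=
  (\sum_(i | std_index i && (w <= weight (std_col i.1))%N) bidet_module i)%MS.

Lemma heavy_module_mxmodule w : mxmodule M (heavy_module w).
Proof. by apply: sumsmx_module => i _; apply: cyclic_mx_module. Qed.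

Lemma heavy_moduleS w w' : (w <= w')%N -> (heavy_module w' <= heavy_module w)%MS.
Proof.
move=> le_w; apply/sumsmx_subP => i /andP[std_i le_i].
by rewrite (sumsmx_sup i) // std_i (leq_trans le_w).
Qed.

Lemma weight_tab_col (lam : intpart n) (t : tableau lam) :
  weight (tab_col t) = weight (std_col lam).
Proof.
rewrite -(diagram_weight (tab_diagram t)) -(diagram_weight (std_diagram lam)).
have [s ->] := tableau_trans (std_tableau lam) t.
rewrite (reindex_inj (@perm_inj _ s)); apply: eq_bigr => x _.
by rewrite tab_row_act permK.
Qed.

(** Only the partition into colour classes matters, and a permutation [s] carries the columns of the
    standard tableau to these classes. *)
Lemma bidet_coloring (c : 'I_n -> nat) (A : tabloid mu) : (forall x, (c x <= n)%N) ->
  exists lam A' s, weight c = weight (std_col lam) /\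
    bidet K c A = bidet K (std_col lam) A' *m M s.
Proof.
move=> c_le; have [lam [t [c_t wt]]] := coloring_tableau c_le.
have [s def_t] := tableau_trans (std_tableau lam) t.
exists lam, (tabloid_act mu A s^-1%g), s; split; first by rewrite wt weight_tab_col.
have -> : bidet K c A = bidet K (tab_col t) A.
  congr (_ *m signed_sum _ _); apply/setP=> u; rewrite !inE.
  by apply: eq_forallb => x; apply: c_t.
rewrite /bidet -col_stabE def_t col_stab_act signed_sum_conj col_stab_std.
by rewrite -tabloid_vec_act !mulmxA.
Qed.

Lemma weight_le (c : 'I_n -> nat) : (weight c <= n.+1 * 2 ^ n)%N.
Proof.
rewrite -[X in (_ <= X * _)%N](card_ord n.+1) -sum_nat_const; apply: leq_sum => j _.
rewrite (leq_trans (leq_pred _)) // leq_pexp2l //.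
by rewrite -[X in (_ <= X)%N](card_ord n) max_card.
Qed.

(** Downward induction on the weight, bounded by [weight_le]: straightening the content leaves
    semistandard contents of the same shape and heavier terms. *)
Lemma bidet_span (c : 'I_n -> nat) A : (forall x, (c x <= n)%N) ->
  (bidet K c A <= heavy_module (weight c))%MS.
Proof.
have [m] := ubnP (n.+1 * 2 ^ n - weight c)%N; elim: m c A => // m IH c A lt_m c_le.
have [lam [A' [s [wt ->]]]] := bidet_coloring A c_le.
rewrite mxmodule_trans ?inE ?heavy_module_mxmodule // {A}.
apply: straighten_content => // [c' A s' c'_le lt_w|A std_A].
  rewrite mxmodule_trans ?inE ?heavy_module_mxmodule //.
  have le_w : (weight (std_col lam) <= weight c')%N by apply: ltnW.
  rewrite wt; apply: submx_trans (heavy_moduleS le_w).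
  apply: IH => //; have := weight_le c'; lia.
apply: (sumsmx_sup (lam, A)); last exact: cyclic_mx_id.
by rewrite /std_index /= std_A wt leqnn.
Qed.

Lemma bidet_modules_span : (1%:M <= \sum_(i | std_index i) bidet_module i)%MS.
Proof.
apply/row_subP => k; rewrite row1.
(* With all colours distinct the stabilizer is trivial, and the bideterminant is the tabloid
   itself. *)
have -> : delta_mx 0 k = bidet K (fun x : 'I_n => x) (enum_val k).
  rewrite /bidet (_ : color_stab _ = [set 1%g]).
    rewrite /signed_sum big_set1 odd_perm1 expr0 scale1r repr_mx1 mulmx1.
    by rewrite /tabloid_vec enum_valK.
  apply/setP=> s; rewrite in_set1.
  apply/color_stabP/eqP => [s1|-> x]; last by rewrite perm1.
  by apply/permP => x; rewrite perm1; apply: ord_inj; apply: s1.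
apply: submx_trans (bidet_span _ _) _; first by move=> x; apply: ltnW.
by apply/sumsmx_subP=> i /andP[std_i _]; apply: (sumsmx_sup i).
Qed.

End Spanning.

(** * Homomorphisms of permutation modules attached to orbits *)

Section OrbitHomomorphisms.

Variables (K : fieldType) (aT : finGroupType) (S T : finType).
Variables (to1 : {action aT &-> S}) (to2 : {action aT &-> T}) (a0 : S) (b0 : T).

(** The orbit of the pair of [a0] and [b0] under the diagonal action; its indicator matrix
    [orbit_hom] is therefore equivariant. *)
Definition pair_orbit (a : S) (b : T) : bool :=
  [exists s, (a == to1 a0 s) && (b == to2 b0 s)].

Definition orbit_hom : 'M[K]_(#|S|, #|T|) :=
  \matrix_(i, j) (pair_orbit (enum_val i) (enum_val j))%:R.

Lemma pair_orbit_act a b g : pair_orbit (to1 a g) b = pair_orbit a (to2 b g^-1%g).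
Proof.
apply/existsP/existsP => [] [s /andP[/eqP eqa /eqP eqb]].
  by exists (s * g^-1)%g; rewrite !actM -eqa -eqb actK !eqxx.
by exists (s * g)%g; rewrite !actM -eqa -eqb actKV !eqxx.
Qed.

Lemma perm_module_orbit_hom g :
  perm_module to1 K g *m orbit_hom = orbit_hom *m perm_module to2 K g.
Proof.
apply/matrixP=> i j; rewrite !mxE.
rewrite (bigD1 (enum_rank (to1 (enum_val i) g))) //= big1 ?addr0; last first.
  move=> k ne_k; rewrite mxE; case: eqP => [Ek|]; last by rewrite mul0r.
  by rewrite -Ek enum_valK eqxx in ne_k.
rewrite (bigD1 (enum_rank (to2 (enum_val j) g^-1%g))) //= big1 ?addr0; last first.
  move=> k ne_k; rewrite mulrC mxE; case: eqP => [Ek|]; last by rewrite mul0r.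
  by rewrite Ek actK enum_valK eqxx in ne_k.
by rewrite !mxE !enum_rankK eqxx actKV eqxx mul1r mulr1 pair_orbit_act.
Qed.

Lemma delta_orbit_hom a :
  delta_mx 0 (enum_rank a) *m orbit_hom
  = \sum_(b | pair_orbit a b) delta_mx 0 (enum_rank b) :> 'rV_#|T|.
Proof.
apply/rowP=> j; rewrite -rowE !mxE enum_rankK summxE.
under eq_bigr => b _ do rewrite mxE /= -(inj_eq enum_val_inj) enum_rankK.
rewrite (big_mkcond (pair_orbit a)) (bigD1 (enum_val j)) //= eqxx big1 ?addr0.
  by case: ifP.
by move=> b ne_b; rewrite eq_sym (negPf ne_b); case: ifP.
Qed.

End OrbitHomomorphisms.

Section IndexHomomorphisms.

Variables (n : nat) (K : fieldType) (mu : intpart n).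
Hypothesis K2 : (2%:R : K) != 0.

Local Notation M := (Mrep mu K).
Local Notation index := (intpart n * tabloid mu)%type.
Implicit Types i j : index.

Definition index_hom i : 'M[K]_(#|tabloid mu|, #|tabloid i.1|) :=
  orbit_hom K (tabloid_act mu) (tabloid_act i.1) i.2 (std_tabloid i.1).

Definition index_weight i := weight (std_col i.1).
Definition index_score i := score (std_row i.1) (tabloid_row i.2).

(** Heavier shapes come first because straightening produces them; among equal weights the row score
    gives the triangularity in [bidet_before]. *)
Definition before j i : bool :=
  (index_weight i < index_weight j)%N
  || (index_weight i == index_weight j) && (index_score j <= index_score i)%N.

Lemma before_total : total before.
Proof. by move=> i j; rewrite /before; case: ltngtP => //= _; apply: leq_total. Qed.

Lemma before_trans : transitive before.
Proof.
move=> j i k; rewrite /before.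
move=> /orP[w1|/andP[/eqP wij sij]] /orP[w2|/andP[/eqP wjk sjk]].
- by rewrite (ltn_trans w2 w1).
- by rewrite wjk w1.
- by rewrite -wij w2.
by rewrite wjk wij eqxx (leq_trans sij sjk) orbT.
Qed.

Lemma index_homJ i s : M s *m index_hom i = index_hom i *m Mrep i.1 K s.
Proof. exact: perm_module_orbit_hom. Qed.

Lemma bidet_index_hom i c A :
  bidet K c A *m index_hom i
  = \sum_(B | pair_orbit (tabloid_act mu) (tabloid_act i.1) i.2 (std_tabloid i.1) A B)
      bidet K c B.
Proof.
rewrite /bidet -mulmx_suml -delta_orbit_hom -/(tabloid_vec K A) -!mulmxA.
congr (_ *m _); rewrite /signed_sum mulmx_suml mulmx_sumr; apply: eq_bigr => s _.
by rewrite -scalemxAl -scalemxAr index_homJ.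
Qed.

Lemma sum_tabloid_row (lam : intpart n) (B : tabloid lam) :
  (\sum_x 2 ^ tabloid_row B x)%N = weight (std_col lam).
Proof.
rewrite -(diagram_weight (std_diagram lam)).
have [s ->] := tabloid_trans (std_tabloid lam) B.
rewrite (reindex_inj (@perm_inj _ s)); apply: eq_bigr => x _.
by rewrite tabloid_row_act permK std_tabloid_row.
Qed.

(** Once [B] is sorted along the columns of [j.1], its values are at least the row numbers there. As
    [j.1] is not lighter than [i.1], comparing sums of powers of 2 forces equality, so the shapes
    agree and the sorted [B] is the standard tabloid. Then [semistandard_unique] compares the
    contents. *)
Lemma bidet_before i j (B : tabloid i.1) :
  std_index i -> std_index j -> before j i ->
  pair_orbit (tabloid_act mu) (tabloid_act i.1) i.2 (std_tabloid i.1) j.2 B ->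
  bidet K (std_col j.1) B != 0 -> j = i /\ B = std_tabloid i.1.
Proof.
case: i j B => [lam A] [lam' A'] /= B; rewrite /std_index /= => std_i std_j bef.
move=> /existsP[s /andP[/eqP defA' /eqP defB]] nzB.
have [h ch incB] := bidet_sorted K2 (proj1 (std_diagram lam')) nzB.
have le_row x := strictly_increasing_ge (std_diagram lam') x incB.
have eq_row : std_row lam' =1 tabloid_row (tabloid_act lam B h).
  have le_exp x : (2 ^ std_row lam' x <= 2 ^ tabloid_row (tabloid_act lam B h) x)%N.
    by rewrite leq_pexp2l ?le_row.
  move=> x; apply/eqP; rewrite -(eqn_exp2l _ _ (ltnSn 1)); apply/eqP.
  apply: (leq_sum_eq le_exp); rewrite sum_tabloid_row (diagram_weight (std_diagram lam')).
  move: bef; rewrite /before /index_weight /= => /orP[/ltnW //|/andP[/eqP -> _]].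
  exact: leqnn.
have def_lam : lam' = lam.
  apply: (@tabloid_row_shape _ _ _ (std_tabloid lam') (tabloid_act lam B h)) => x.
  by rewrite std_tabloid_row eq_row.
subst lam'.
have Bh : tabloid_act lam B h = std_tabloid lam.
  by apply: tabloid_row_inj => x; rewrite -eq_row std_tabloid_row.
(* As [k] fixes the standard tabloid, it permutes within rows. *)
pose k := (s * h)%g.
have kB0 : tabloid_act lam (std_tabloid lam) k = std_tabloid lam by rewrite actM -defB Bh.
have rk : k^-1%g \in color_stab (std_row lam).
  by apply/color_stabP=> x; rewrite -!std_tabloid_row -{2}kB0 tabloid_row_act.
have chV : h^-1%g \in color_stab (std_col lam) by rewrite (groupV (color_stab_group _)).
have [||h1 eqA] := semistandard_unique std_i std_j chV rk.
- by move=> x; rewrite defA' tabloid_row_act -permM -invMg.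
- by move: bef; rewrite /before /index_weight /index_score /= ltnn eqxx.
split; first by congr pair; apply: tabloid_row_inj => x; rewrite eqA.
by rewrite -Bh -[h]invgK h1 invg1 act1.
Qed.

End IndexHomomorphisms.

(** * Linear independence of the standard polytabloids *)

Section StandardPolytabloids.

Variables (n : nat) (K : fieldType) (lam : intpart n).

Local Notation M := (Mrep lam K).
Local Notation e := (polytabloid K (std_tableau lam)).

Definition standard (s : 'S_n) : bool := semistandard lam (fun x => s x).

(** On standard permutations this matrix is unitriangular for the row score. *)
Definition std_coef (s s' : 'S_n) : K :=
  (e *m M s) 0 (enum_rank (tabloid_act lam (std_tabloid lam) s')).

Lemma std_coefE s s' : std_coef s s' = \sum_(h in color_stab (std_col lam))
  (-1) ^+ odd_perm h * (tabloid_act lam (std_tabloid lam) s'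
                        == tabloid_act lam (std_tabloid lam) (h * s)%g)%:R.
Proof.
rewrite /std_coef /polytabloid -[tabloid_of _]/(std_tabloid lam) col_stab_std.
rewrite mulmx_sumr mulmx_suml summxE; apply: eq_bigr => h _.
rewrite -scalemxAr -scalemxAl mxE; congr (_ * _).
rewrite -mulmxA -repr_mxM ?inE // tabloid_vec_act !mxE /=.
by rewrite (inj_eq enum_rank_inj).
Qed.

Lemma standard_act_eq s s' h : standard s -> standard s' ->
  (score (std_row lam) (fun x => s x) <= score (std_row lam) (fun x => s' x))%N ->
  h \in color_stab (std_col lam) ->
  tabloid_act lam (std_tabloid lam) s' = tabloid_act lam (std_tabloid lam) (h * s)%g ->
  h = 1%g /\ s = s'.
Proof.
move=> std_s std_s' le_score ch eqB.
pose k := (h * s * s'^-1)%g.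
have kB : tabloid_act lam (std_tabloid lam) k = std_tabloid lam.
  by rewrite actM -eqB actK.
have rk : k \in color_stab (std_row lam).
  apply/color_stabP=> x; rewrite -!std_tabloid_row -[in LHS]kB tabloid_row_act.
  by rewrite permK.
have [||h1 eq_s] := semistandard_unique std_s' std_s ch rk => //.
  by move=> x; rewrite /k !permM permKV.
by split=> //; apply/permP => x; apply: ord_inj; rewrite -eq_s.
Qed.

Lemma std_coef_diag s : standard s -> std_coef s s = 1.
Proof.
move=> std_s; rewrite std_coefE (sum_unique (i0 := 1%g)) //.
  by rewrite odd_perm1 mul1g eqxx mul1r.
move=> h ch; rewrite mulr_natr mulrb; case: ifP => [/eqP eqB _|_]; last by rewrite eqxx.
by have [] := standard_act_eq std_s std_s (leqnn _) ch eqB.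
Qed.

Lemma std_coef_triangular s s' : standard s -> standard s' ->
  (score (std_row lam) (fun x => s x) <= score (std_row lam) (fun x => s' x))%N ->
  std_coef s s' != 0 -> s = s'.
Proof.
move=> std_s std_s' le_score; rewrite std_coefE => nz; apply: contraNeq nz => ne_s.
rewrite big1 // => h ch; rewrite mulr_natr mulrb; case: ifP => // /eqP eqB.
have [_ /eqP] := standard_act_eq std_s std_s' le_score ch eqB.
by rewrite (negPf ne_s).
Qed.

(** Among the terms with nonzero coefficient, take [s'] of largest row score: at its tabloid no
    other term contributes. *)
Lemma standard_free (a : 'S_n -> K) :
  \sum_(s | standard s) a s *: (e *m M s) = 0 -> forall s, standard s -> a s = 0.
Proof.
move=> sum0 s std_s; apply/eqP; apply: contraT => nz_s.
have Ps : [pred u | standard u & a u != 0] s by rewrite /= std_s.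
case: (arg_maxnP (fun s : 'S_n => score (std_row lam) (fun x => s x)) Ps).
move=> s' /andP[std_s' nz_s'] max_s'.
have := congr1 (fun x : 'rV[K]__ =>
  x 0 (enum_rank (tabloid_act lam (std_tabloid lam) s'))) sum0.
rewrite /= summxE mxE => sum_coef.
have : \sum_(u | standard u) a u * std_coef u s' = 0.
  by rewrite -[RHS]sum_coef; apply: eq_bigr => u _; rewrite mxE.
rewrite (sum_unique (i0 := s')) // => [/eqP|u std_u].
  by rewrite std_coef_diag // mulr1 (negPf nz_s').
rewrite mulf_eq0 negb_or => /andP[nz_u]; apply: std_coef_triangular => //.
by apply: max_s'; rewrite /= std_u.
Qed.

End StandardPolytabloids.

(** * Identification of the sections with Specht modules *)

Section BidetSections.

Variables (n : nat) (K : fieldType) (mu : intpart n).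
Hypothesis K2 : (2%:R : K) != 0.

Local Notation M := (Mrep mu K).
Local Notation index := (intpart n * tabloid mu)%type.
Implicit Types i j : index.

Lemma bidet_std_tabloid (lam : intpart n) :
  bidet K (std_col lam) (std_tabloid lam) = polytabloid K (std_tableau lam).
Proof. by rewrite /polytabloid col_stab_std. Qed.

Lemma bidet_index_hom_eq0 i j : std_index i -> std_index j -> before j i -> j != i ->
  bidet K (std_col j.1) j.2 *m index_hom K i = 0.
Proof.
move=> std_i std_j bef ne_ij; rewrite bidet_index_hom big1 // => B orbB.
apply/eqP; apply: contraNT ne_ij => nzB.
by have [-> _] := bidet_before K2 std_i std_j bef orbB nzB.
Qed.

Lemma bidet_module_index_hom_eq0 i j :
  std_index i -> std_index j -> before j i -> j != i ->
  bidet_module K j *m index_hom K i = 0.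
Proof.
move=> std_i std_j bef ne_ij; apply/sub_kermxP.
apply: cyclic_mx_subP => s _; apply/sub_kermxP.
by rewrite -mulmxA index_homJ mulmxA bidet_index_hom_eq0 // mul0mx.
Qed.

Lemma bidet_index_hom_std i : std_index i ->
  bidet K (std_col i.1) i.2 *m index_hom K i = polytabloid K (std_tableau i.1).
Proof.
move=> std_i; have bef : before i i by rewrite /before eqxx leqnn orbT.
rewrite bidet_index_hom -bidet_std_tabloid; apply: sum_unique.
  by apply/existsP; exists 1%g; rewrite !act1 !eqxx.
by move=> B orbB nzB; have [_ ->] := bidet_before K2 std_i std_i bef orbB nzB.
Qed.

Lemma bidet_module_index_hom i : std_index i ->
  (bidet_module K i *m index_hom K i :=: specht_mx i.1 K)%MS.
Proof.
move=> std_i; rewrite /specht_mx -(bidet_index_hom_std std_i).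
by apply: cyclic_mx_hom => s _; apply: index_homJ.
Qed.

(** The homomorphism of [i] maps onto the Specht module. Modulo [V], which contains all heavier
    terms, straightening the places leaves only standard ones; their images are the standard
    polytabloids, which are independent, so the kernel lies in [V]. *)
Lemma bidet_module_section i (V : 'M_#|tabloid mu|) :
  std_index i -> mxmodule M V -> V *m index_hom K i = 0 ->
  (heavy_module K mu (weight (std_col i.1)).+1 <= V)%MS ->
  is_section M (specht_repr i.1 K) V (V + bidet_module K i)%MS.
Proof.
move=> std_i modV VC0 heavyV; set C := index_hom K i.
apply: (section_of_hom (C := C)) => //.
- by move=> s _; apply: index_homJ.
- apply: eqmx_trans (addsmxMr _ _ _) _; rewrite VC0.
  exact: eqmx_trans (adds0mx _ _) (bidet_module_index_hom std_i).
apply: (kernel_of_free_lifts (P := @standard n i.1)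
  (b := fun s => bidet K (std_col i.1) i.2 *m M s)) => //.
  rewrite addsmx_sub addsmxSl; apply: cyclic_mx_subP => s _; move: s.
  apply: (straighten_place K2) => [c' A s c'_le lt_w|s std_s].
    apply: submx_trans (addsmxSl _ _); rewrite mxmodule_trans ?inE //.
    apply: submx_trans (bidet_span K2 _ c'_le) _.
    exact: submx_trans (heavy_moduleS _ _ lt_w) heavyV.
  apply: submx_trans (addsmxSr _ _).
  exact: (sub_span_mx (fun s => bidet K (std_col i.1) i.2 *m M s) std_s).
move=> a aC0; apply: (standard_free (K := K)); rewrite -[RHS]aC0.
apply: eq_bigr => s _; congr (_ *: _).
by rewrite -[RHS]mulmxA index_homJ mulmxA bidet_index_hom_std.
Qed.

End BidetSections.

(** * The Specht filtration for one symmetric group *)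

Section SpechtChain.

Variables (n : nat) (K : fieldType).

Inductive is_specht : forall d, mx_representation K [set: 'S_n] d -> Prop :=
  IsSpecht (al : intpart n) : is_specht (specht_repr al K).

Variable mu : intpart n.
Hypothesis K2 : (2%:R : K) != 0.

Local Notation M := (Mrep mu K).
Local Notation index := (intpart n * tabloid mu)%type.

Lemma Mrep_chain : chain is_specht M 0 1%:M.
Proof.
have eq1 : (\sum_(i : index | std_index i) bidet_module K i :=: 1%:M)%MS.
  by apply/eqmxP; rewrite submx1; apply: bidet_modules_span mu K2.
apply: chain_eqmx eq1.
apply: (chain_of_order (@before_total n mu) (@before_trans n mu)).
  by move=> i _; apply: cyclic_mx_module.
move=> i V std_i modV V_ge V_le; exists _, (specht_repr i.1 K); split.
  exact: IsSpecht.
apply: (bidet_module_section K2 std_i modV).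
  (* [V] lies in the sum of the modules of earlier indices, each of which the homomorphism of [i]
     kills. *)
  apply/sub_kermxP; apply: V_le => j std_j bef ne_j; apply/sub_kermxP.
  exact: (bidet_module_index_hom_eq0 K2 std_i std_j bef ne_j).
(* Indices of strictly larger weight come strictly before [i]. *)
apply/sumsmx_subP => j /andP[std_j lt_w]; apply: (V_ge j std_j).
rewrite /before /index_weight negb_or -leqNgt (ltnW lt_w) /=.
by rewrite (gtn_eqF lt_w).
Qed.

End SpechtChain.

(** * Products of two symmetric groups and passage to duals *)

Section PairOfGroups.

Variables (K : fieldType) (a b : nat).

Inductive is_specht2 : forall d, mx_representation K (Sym_prod a b) d -> Prop :=
  IsSpecht2 (al : intpart a) (be : intpart b) : is_specht2 (specht_repr2 K al be).

Inductive is_dual_specht : forall d, mx_representation K (Sym_prod a b) d -> Prop :=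
  IsDualSpecht (al : intpart a) (be : intpart b) : is_dual_specht (dual_specht K al be).

(** Tensor products of permutation matrices are orthogonal, so the module is its own dual in the
    tabloid basis. *)
Lemma Mrep2_dual (lam : intpart a) (mu : intpart b) g :
  Mrep2 K lam mu g = (Mrep2 K lam mu g^-1%g)^T.
Proof. by rewrite /= /outer_mx trmx_tens !trmx_Mrep !invgK. Qed.

(** Annihilators reverse the tensor product of the two Specht chains and exchange 0 with the whole
    module. *)
Lemma Mrep2_chain (lam : intpart a) (mu : intpart b) : (2%:R : K) != 0 ->
  chain is_dual_specht (Mrep2 K lam mu) 0 1%:M.
Proof.
move=> K2; have ch2 : chain is_specht2 (Mrep2 K lam mu) 0 1%:M.
  apply: chain_tensor (Mrep_chain lam K2) (Mrep_chain mu K2).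
  by move=> d1 d2 s1 s2 [al] [be]; apply: IsSpecht2.
have dual_specht_of d (r : mx_representation K (Sym_prod a b) d) :
    is_specht2 r -> is_dual_specht (dual_repr r).
  by case=> al be; apply: IsDualSpecht.
have := chain_dual (fun g _ => Mrep2_dual lam mu g) dual_specht_of ch2.
pose N := (#|tabloid lam| * #|tabloid mu|)%N.
have ann1 : (annihilator (1%:M : 'M[K]_N) :=: (0 : 'M[K]_N))%MS.
  apply/eqmxP; rewrite sub0mx andbT submx0 -[annihilator _]mulmx1.
  by rewrite -[X in _ *m X]trmx1 annihilator_mul.
move=> ch; apply: chain_eqmx (chain_eqmxl _ _ ch) _.
- exact: eqmx_sym.
- exact: chain_modulel ch.
by apply/eqmxP; rewrite submx1 sub_annihilator trmx0 mulmx0 eqxx.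
Qed.

End PairOfGroups.

Theorem proposition3p10 (K : fieldType)
    (hK2 : 2%N \notin [pchar K]%R) (hK3 : 3%N \notin [pchar K]%R)
    (a b : nat) (lam : intpart a) (mu : intpart b) :
  has_dual_specht_filtration (Mrep2 K lam mu).

Proof.
have K2 : (2%:R : K) != 0 by move: hK2; rewrite inE.
have [N [W [modW [W0 WN sW secW]]]] := chain_seq (Mrep2_chain lam mu K2).
(* A filtration has at least one section, so a chain of length 0 is excluded: the module is nonzero,
   having a basis vector for the pair of standard tabloids. *)
case: N WN sW secW => [W0' _ _|k Wk sW secW].
  have : (1%:M <= (0 : 'M[K]_(#|tabloid lam| * #|tabloid mu|)))%MS by rewrite -W0 W0'.
  rewrite submx0 => /eqP /matrixP.
  pose i := mxtens_index (enum_rank (std_tabloid lam), enum_rank (std_tabloid mu)).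
  by move=> /(_ i i) /eqP; rewrite !mxE eqxx oner_eq0.
exists k, W, modW; split=> // i le_ik.
by have [d [r [[al be] sim]]] := secW i le_ik; exists al, be.
Qed.
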